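(* Let $d\ge 1$ and let $p\in[0,1]$ with $p<1/(2d)$. Then there exists a quasilocal specification $\gamma'$ for the measure $\mu'_p=\mu_p\circ T^{-1}$, the image of the i.i.d. Bernoulli field $\mu_p$ on $\mathbb{Z}^d$ under the projection $T$ to the non-isolates.
   Context: Let $\Omega=\{0,1\}^{\mathbb{Z}^d}$ with the product topology and product $\sigma$-algebra. For $p\in[0,1]$, $\mu_p$ is the i.i.d. Bernoulli product measure on $\Omega$ with $\mu_p(\omega_x=1)=p$. For $x\in\mathbb{Z}^d$, $\partial x$ denotes the set of the $2d$ nearest neighbours of $x$. The map $T:\Omega\to\Omega$ (projection to the non-isolates) is $$(T\omega)_x=\omega_x\Bigl(1-\prod_{y\in\partial x}(1-\omega_y)\Bigr),$$ i.e. it removes all occupied sites having no occupied nearest neighbour. Put $\Omega'=T(\Omega)$, equipped with the (subspace) product topology, and $\mu'_p=\mu_p\circ T^{-1}$, a probability measure supported on $\Omega'$. Notation: $\Lambda\Subset\mathbb{Z}^d$ means that $\Lambda$ is a finite subset; $\Lambda^c=\mathbb{Z}^d\setminus\Lambda$; $\omega_\Lambda$ is the restriction of $\omega$ to $\Lambda$; $\mathcal{F}'_{\Lambda^c}$ is the $\sigma$-algebra on $\Omega'$ generated by the coordinates in $\Lambda^c$. A specification (on $\Omega'$) is a family $\gamma'=(\gamma'_\Lambda)_{\Lambda\Subset\mathbb{Z}^d}$ of probability kernels $\gamma'_\Lambda(\cdot\mid\omega')$ on $\Omega'$, $\omega'\in\Omega'$, with $\omega'\mapsto\gamma'_\Lambda(A\mid\omega')$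 being $\mathcal{F}'_{\Lambda^c}$-measurable for each measurable $A$, which is proper (under $\gamma'_\Lambda(\cdot\mid\omega')$ the configuration on $\Lambda^c$ equals $\omega'_{\Lambda^c}$ with probability one) and consistent ($\int\gamma'_\Delta(d\tilde\omega\mid\hat\omega)\,\gamma'_\Lambda(A\mid\tilde\omega)=\gamma'_\Delta(A\mid\hat\omega)$ for all $\Lambda\subset\Delta\Subset\mathbb{Z}^d$, all $\hat\omega\in\Omega'$ and all measurable $A$). It is quasilocal if for all $\Lambda\Subset\mathbb{Z}^d$ and all $\hat\omega_\Lambda\in\{0,1\}^\Lambda$ the map $\omega'\mapsto\gamma'_\Lambda(\{\sigma'\in\Omega':\sigma'_\Lambda=\hat\omega_\Lambda\}\mid\omega')$ is continuous on $\Omega'$ in the product topology. It is a specification for a probability measure $\mu'$ on $\Omega'$ if the DLR equations hold: $\int\mu'(d\tilde\omega)\,\gamma'_\Lambda(A\mid\tilde\omega)=\mu'(A)$ for all $\Lambda\Subset\mathbb{Z}^d$ and measurable $A$. *)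

(* Defs.v *)
From HB Require Import structures.
From mathcomp Require Import all_boot all_order all_algebra finmap.
From mathcomp Require Import all_classical all_reals all_analysis.

Set Implicit Arguments.
Unset Strict Implicit.
Unset Printing Implicit Defensive.

Import Order.TTheory GRing.Theory Num.Theory.
Import numFieldNormedType.Exports.

Local Open Scope classical_set_scope.
Local Open Scope ring_scope.

Notation site d := {ffun 'I_d -> int}.

Definition basis_site d (i : 'I_d) : site d := [ffun j => (j == i)%:Z].

Definition boundary d (x : site d) : {fset site d} :=
  ([fset (x + basis_site i)%R | i in 'I_d] `|`
   [fset (x - basis_site i)%R | i in 'I_d])%fset.

(* The events generated by the coordinates in S of the random configuration
   X : U -> {0,1}^(Z^d). *)
Definition coordinate_events d (U : Type) (X : U -> site d -> bool)
    (S : set (site d)) : set (set U) :=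
  \bigcup_(x in S) preimage_set_system setT (fun u => X u x) measurable.

Definition config (d : nat) := site d -> bool.

HB.instance Definition _ d :=
  Topological.copy (config d) {ptws site d -> bool}.
HB.instance Definition _ d := isPointed.Build (config d) (fun=> false).
HB.instance Definition _ d := Measurable.copy (config d)
  (g_sigma_algebraType (@coordinate_events d (config d) id setT)).

(* w_x (1 - \prod_y (1 - w_y)) for {0,1}-valued w, with bool for {0,1}:
   the product is && and 1 - _ is ~~. *)
Definition nonisolates d (w : config d) : config d :=
  fun x => w x && ~~ \big[andb/true]_(y <- boundary x) ~~ w y.

Definition config' (d : nat) := set_type (range (@nonisolates d)).

Definition nonisolates' d (w : config d) : config' d :=
  exist _ (nonisolates w) (mem_set (imageP (@nonisolates d) (I : setT w))).

HB.instance Definition _ d :=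
  Topological.copy (config' d) (set_type (range (@nonisolates d))).
HB.instance Definition _ d :=
  isPointed.Build (config' d) (nonisolates' (fun=> false)).
HB.instance Definition _ d := Measurable.copy (config' d)
  (g_sigma_algebraType (@coordinate_events d (config' d) val setT)).

Lemma measurable_coordinate d (x : site d) :
  measurable_fun setT (fun w : config d => w x).
Proof.
by move=> _ B mB; apply: sub_sigma_algebra; exists x => //; exists B.
Qed.

Lemma measurable_nonisolates' d : measurable_fun setT (@nonisolates' d).
Proof.
apply: (measurability (@coordinate_events d (config' d) val setT)) => //.
move=> _ [_ [x _ [B mB <-]] <-]; rewrite setTI.
have bigP (s : seq (site d)) : measurable_fun setT
    (fun w : config d => \big[andb/true]_(y <- s) ~~ w y).
  elim: s => [|y s IH].
    apply: (eq_measurable_fun (cst true)) => //.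
    by move=> w _ /=; rewrite big_nil.
  apply: (eq_measurable_fun
    (fun w : config d => ~~ w y && \big[andb/true]_(z <- s) ~~ w z)).
    by move=> w _ /=; rewrite big_cons.
  apply: measurable_and => //; apply: measurable_neg.
  exact: measurable_coordinate.
suff : measurable_fun setT (fun w : config d => nonisolates w x) by apply.
apply: measurable_and; first exact: measurable_coordinate.
exact: measurable_neg.
Qed.

HB.instance Definition _ d :=
  isMeasurableFun.Build _ _ _ _ (@nonisolates' d) (@measurable_nonisolates' d).

(* mu is the i.i.d. Bernoulli(p) product measure. *)
Definition bernoulli_product (R : realType) d (p : R)
    (mu : probability (config d) R) :=
  forall (L : {fset site d}) (eta : {ffun L -> bool}),
    mu [set w | forall x : L, w (val x) = eta x] =
    (\prod_(x : L) bernoulli_pmf p (eta x))%:E.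

(* Same points as config' d, with the sigma-algebra F'_{L^c} generated by the
   coordinates outside L. *)
Definition config'_out d (L : {fset site d}) :=
  g_sigma_algebraType (@coordinate_events d (config' d) val (~` [set` L])).

(* F'_{L^c}-measurability of w |-> gamma_L(A | w) is part of the kernel type. *)
Record specification (R : realType) d := Specification {
  spec_kernel :> forall L : {fset site d},
    R.-pker (config'_out L) ~> (config' d) ;
  spec_proper : forall (L : {fset site d}) (w : config' d),
    spec_kernel L w
      [set s : config' d | forall x, x \notin L -> val s x = val w x] = 1%E ;
  spec_consistent : forall (L D : {fset site d}), (L `<=` D)%fset ->
    forall (w : config' d) (A : set (config' d)), measurable A ->
    (\int[spec_kernel D w]_v spec_kernel L v A = spec_kernel D w A)%E
}.

Definition quasilocal (R : realType) d (gamma : specification R d) :=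
  forall (L : {fset site d}) (eta : {ffun L -> bool}),
    continuous (fun w : config' d =>
      gamma L w [set s : config' d | forall x : L, val s (val x) = eta x]).

Definition specification_for (R : realType) d (gamma : specification R d)
    (mu' : probability (config' d) R) :=
  forall (L : {fset site d}) (A : set (config' d)), measurable A ->
    (\int[mu']_w gamma L w A = mu' A)%E.

(* Main.v *)
Require Import Defs.
From HB Require Import structures.
From mathcomp Require Import all_boot all_order all_algebra finmap.
From mathcomp Require Import all_classical all_reals all_analysis.
From mathcomp Require Import measurable_realfun.
From mathcomp Require Import ring lra.
Import Order.TTheory GRing.Theory Num.Theory.
Import numFieldNormedType.Exports.
Set Implicit Arguments.
Unset Strict Implicit.
Unset Printing Implicit Defensive.
Local Open Scope classical_set_scope.
Local Open Scope ring_scope.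

(** The visible configuration has no isolated site, and every such
    configuration is its own projection. Let [u D s] be the probability that
    [s] is seen in a finite window [D]. In [D], the conditional probability of a
    pattern on [L] given the pattern on the rest of [D] is [u D s] divided by
    the sum of [u D] over all ways to change [s] on [L]. For [0 < p] the
    denominator is positive as soon as one of these changes has no isolated site,
    and the quotients satisfy in each window the identities required of a
    specification. It therefore suffices that they converge as [D] grows,
    uniformly over these configurations: each quotient is a local function, so
    the limit is quasilocal, and the algebraic identities pass to the limit.
    This reduction is the record [conditional_densities] with
    [specification_of_densities]; the DLR equation is checked on local events,
    where it holds exactly in every large window ([splice_exchange]), and
    extended by uniqueness of measures.

    For the convergence, condition on seeing [s] in [D]. The field is then
    forced to be occupied where [s] is; on the rest of the window it is a
    hard-core gas, because an occupied site that is not seen has only empty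
    neighbours. Removing such a site changes nothing visible
    ([nonisolates_set_site]), which gives the hard-core recursion
    [void_prob_rec]: the conditional probability that [x] is empty is
    [1 / (1 + p / (1 - p) * P]), where [P] is the conditional probability that
    the neighbours of [x] are empty given that [x] is. Expanding [P] one
    neighbour at a time into at most [2 d] factors, each between [1 - p] and [1],
    and using that the map is [p]-Lipschitz in each of them
    ([hardcore_lipschitz]), one step of the recursion contracts the distance
    between two windows by [2 d p < 1]. Void probabilities in two windows that
    both contain the ball of radius [r] thus differ by at most [(2 d p) ^ r]
    per site ([void_ratio_dist]).

    Void probabilities determine [u]: when the field agrees with [s] near [L],
    its pattern on [L] can be exchanged at the cost of an explicit weight, so
    [u D s] is that weight, times a factor that ignores [L], divided by the
    probability that all invisible sites near [L] are empty. The factor in the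
    middle depends on the window in an uncontrolled way, but it cancels in the
    quotient ([normalized_dist]).

    For [p = 0] only the empty configuration is seen, and conditional
    probabilities do not determine the specification elsewhere. The uniform
    distribution on the admissible patterns with the fewest occupied sites
    serves instead ([ground_densities]). *)

(** * Local functions and splicing *)

Definition local_on d (S : {fset site d}) (U : Type) (f : config d -> U) :=
  forall v w : config d, {in S, v =1 w} -> f v = f w.

Definition splice d (L : {fset site d}) (eta : {ffun L -> bool})
    (w : config d) : config d :=
  fun x => if (insub x : option L) is Some y then eta y else w x.

Definition restr d (L : {fset site d}) (w : config d) : {ffun L -> bool} :=
  [ffun y => w (val y)].

Section Splice.
Context (d : nat).
Implicit Types (L D S : {fset site d}) (v w : config d) (x y : site d).

Lemma splice_val L (eta : {ffun L -> bool}) w (y : L) :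
  splice eta w (val y) = eta y.
Proof. by rewrite /splice valK. Qed.

Lemma splice_out L (eta : {ffun L -> bool}) w x :
  x \notin L -> splice eta w x = w x.
Proof. by move=> xL; rewrite /splice insubN. Qed.

Lemma splice_restr_in L v w x : x \in L -> splice (restr L v) w x = v x.
Proof. by move=> xL; rewrite /splice insubT /= ffunE. Qed.

Lemma splice_restr L v w :
  (forall x, x \notin L -> v x = w x) -> splice (restr L v) w = v.
Proof.
move=> vw; apply/funext => x; have [xL|xL] := boolP (x \in L).
  exact: splice_restr_in.
by rewrite splice_out// vw.
Qed.

Lemma splice_widen L D (eta : {ffun L -> bool}) w : (L `<=` D)%fset ->
  splice (restr D (splice eta w)) w = splice eta w.
Proof.
move=> /fsubsetP LD; apply: splice_restr => x xD; rewrite splice_out//.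
by apply: contra xD => /LD.
Qed.

Lemma restr_splice L (eta : {ffun L -> bool}) w : restr L (splice eta w) = eta.
Proof. by apply/ffunP => y; rewrite ffunE splice_val. Qed.

Lemma splice_splice L (eta zeta : {ffun L -> bool}) w :
  splice eta (splice zeta w) = splice eta w.
Proof.
apply/funext => x; have [xL|xL] := boolP (x \in L).
  by rewrite /splice insubT.
by rewrite !splice_out.
Qed.

Lemma splice_agree L S (eta : {ffun L -> bool}) v w :
  {in S, v =1 w} -> {in S, splice eta v =1 splice eta w}.
Proof.
move=> vw x xS; rewrite /splice; case: insub => [//|]; exact: vw.
Qed.

Lemma splice_restr_agree S v w : {in S, splice (restr S v) w =1 v}.
Proof. by move=> x; apply: splice_restr_in. Qed.

Lemma local_on_sub S D (U : Type) (f : config d -> U) :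
  (S `<=` D)%fset -> local_on S f -> local_on D f.
Proof. by move=> /fsubsetP SD fS v w vw; apply: fS => x /SD /vw. Qed.

(** The pair formed by a configuration and its modification on [L] can be
    swapped, which permutes the pairs of patterns. Reversibility of resampling
    rests on this, and with it consistency and the DLR equation. *)
Lemma splice_exchange (V : nmodType) L D (F : config d -> config d -> V) w :
    (L `<=` D)%fset ->
  \sum_(zeta : {ffun D -> bool}) \sum_(eta : {ffun L -> bool})
     F (splice zeta w) (splice eta (splice zeta w)) =
  \sum_(zeta : {ffun D -> bool}) \sum_(eta : {ffun L -> bool})
     F (splice eta (splice zeta w)) (splice zeta w).
Proof.
move=> /fsubsetP LD; rewrite !pair_bigA /=.
pose h (q : {ffun D -> bool} * {ffun L -> bool}) :=
  (restr D (splice q.2 (splice q.1 w)), restr L (splice q.1 w)).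
have h1 q : splice (h q).1 w = splice q.2 (splice q.1 w).
  apply: splice_restr => x xD; rewrite splice_out ?splice_out//.
  by apply: contra xD => /LD.
have h2 q : splice (h q).2 (splice (h q).1 w) = splice q.1 w.
  by rewrite h1; apply: splice_restr => x xL; rewrite [RHS]splice_out.
have hK : involutive h.
  move=> q; rewrite [LHS]surjective_pairing [RHS]surjective_pairing.
  congr pair; first by rewrite [LHS]/= h2 restr_splice.
  by rewrite [LHS]/= h1 restr_splice.
rewrite (reindex_inj (inv_inj hK)) /=; apply: eq_bigr => q _.
by rewrite -[X in F X _]/(splice (h q).1 w) h2 h1.
Qed.

Lemma splice_sum (V : nmodType) L (F : config d -> V) (eta : {ffun L -> bool}) w :
  \sum_(zeta : {ffun L -> bool}) F (splice zeta (splice eta w)) =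
  \sum_(zeta : {ffun L -> bool}) F (splice zeta w).
Proof. by apply: eq_bigr => zeta _; rewrite splice_splice. Qed.

End Splice.

(** * Non-isolated configurations *)

Section NonIsolated.
Context (d : nat).
Implicit Types (v w : config d) (x y : site d).

Lemma boundaryC x y : (y \in boundary x) = (x \in boundary y).
Proof.
suff sub (a b : site d) : a \in boundary b -> b \in boundary a.
  by apply/idP/idP => /sub.
rewrite /boundary => /fsetUP[] /imfsetP[i /= _ ->]; rewrite !inE.
  by apply/orP; right; apply/imfsetP; exists i => //=; rewrite addrK.
by apply/orP; left; apply/imfsetP; exists i => //=; rewrite subrK.
Qed.

Lemma size_boundary x : (size (boundary x) <= 2 * d)%N.
Proof.
have card_im (f : 'I_d -> site d) : (#|` [fset f i | i in 'I_d]%fset| <= d)%N.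
  by apply: leq_trans (leq_imfset_card _ _ _) _; rewrite -cardE card_ord.
rewrite mul2n -addnn; apply: leq_trans (leq_add (card_im _) (card_im _)).
by rewrite /boundary cardfsU; apply: leq_subr.
Qed.

Lemma nonisolatesE w x : nonisolates w x = w x && has w (boundary x).
Proof.
rewrite /nonisolates big_all -has_predC; congr andb.
by apply: eq_has => y /=; rewrite negbK.
Qed.

Lemma nonisolates_sub w x : nonisolates w x -> w x.
Proof. by rewrite nonisolatesE => /andP[]. Qed.

Lemma nonisolates_pair w x y :
  w x -> w y -> y \in boundary x -> nonisolates w x.
Proof. by move=> wx wy yx; rewrite nonisolatesE wx; apply/hasP; exists y. Qed.

Lemma nonisolates_has w x :
  nonisolates w x -> exists2 y, y \in boundary x & nonisolates w y.
Proof.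
rewrite nonisolatesE => /andP[wx /hasP[y yx wy]]; exists y => //.
by apply: (@nonisolates_pair _ _ x) => //; rewrite boundaryC.
Qed.

Lemma nonisolatesK w : nonisolates (nonisolates w) = nonisolates w.
Proof.
apply/funext => x; apply/idP/idP => [/nonisolates_sub//|Tx].
have [y yx Ty] := nonisolates_has Tx; exact: nonisolates_pair yx.
Qed.

Lemma nonisolates_val (w : config' d) : nonisolates (val w) = val w.
Proof. by case: w => v /=; rewrite inE => -[u _ <-]; exact: nonisolatesK. Qed.

End NonIsolated.

(** * Measurability and continuity of local functions *)

Section Regularity.
Context (d : nat).
Implicit Types (L S : {fset site d}).

(** A local function takes finitely many values, each on a finite union of
    cylinders. *)
Lemma measurable_local dV (V : measurableType dV) S (f : config d -> V) :
  local_on S f -> measurable_fun setT f.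
Proof.
move=> fS _ B mB; rewrite setTI.
pose cyl (eta : {ffun S -> bool}) :=
  [set w : config d | forall y : S, w (val y) = eta y].
have mcyl eta : measurable (cyl eta).
  rewrite (_ : cyl eta = \bigcap_(y in [set: S])
      [set w : config d | w (val y) = eta y]); last first.
    by apply/seteqP; split => u /= cu y; [move=> _|]; apply: cu.
  apply: fin_bigcap_measurable; first exact: finite_finset.
  by move=> y _; have := measurable_coordinate (val y) measurableT
    (Y := [set eta y]); rewrite setTI; apply.
rewrite (_ : _ @^-1` B =
    \bigcup_(eta in [set eta | B (f (splice eta (fun=> false)))]) cyl eta); last first.
  apply/seteqP; split => [w Bfw|w [eta /= Beta weta]].
    exists (restr S w) => /=; last by move=> y; rewrite ffunE.
    by rewrite (fS _ w)//; exact: splice_restr_agree.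
  rewrite /preimage /= (fS _ (splice eta (fun=> false)))// => x xS.
  by rewrite (weta [` xS]%fset) -(splice_val eta (fun=> false)).
by apply: fin_bigcup_measurable => //; exact: finite_finset.
Qed.

Lemma measurable_to_config dU (U : measurableType dU) (X : U -> config d) :
  (forall x, measurable_fun setT (fun u => X u x)) -> measurable_fun setT X.
Proof.
move=> mX; apply: (measurability (@coordinate_events d (config d) id setT)) => //.
move=> _ [_ [x _ [B mB <-]] <-]; rewrite !setTI.
by have := mX x measurableT B mB; rewrite setTI.
Qed.

Lemma measurable_config'_val : measurable_fun setT (val : config' d -> config d).
Proof.
apply: measurable_to_config => x _ B mB.
by apply: sub_sigma_algebra; exists x => //; exists B.
Qed.

Lemma measurable_splice L (eta : {ffun L -> bool}) :
  measurable_fun setT (fun w : config'_out L => splice eta (val w)).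
Proof.
apply: measurable_to_config => x; have [xL|xL] := boolP (x \in L).
  apply: (eq_measurable_fun (cst (eta [` xL]%fset))) => // w _.
  by rewrite -[x]/(val [` xL]%fset) splice_val.
apply: (eq_measurable_fun (fun w : config'_out L => val w x)).
  by move=> w _; rewrite splice_out.
move=> _ B mB; apply: sub_sigma_algebra; exists x; last by exists B.
by apply/negP.
Qed.

Lemma measurable_id_out L :
  @measurable_fun _ _ (config' d) (config'_out L) setT id.
Proof.
apply: (@measurability _ _ (config' d) (config'_out L) setT id
  (@coordinate_events d (config' d) val (~` [set` L]))) => //.
move=> _ [_ [x _ [B mB <-]] <-]; apply: measurableI => //.
by apply: sub_sigma_algebra; exists x => //; exists B.
Qed.

Lemma near_config'_agree S (w : config' d) :
  \forall v \near w, {in S, val v =1 val w}.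
Proof.
have near1 x : \forall v \near w, val v x = val w x.
  have cval : continuous (val : config' d -> {ptws site d -> bool}).
    exact: initial_continuous.
  have cproj : continuous (fun v : {ptws site d -> bool} => v x).
    exact: (@proj_continuous _ (fun=> bool) x).
  have cx : (fun v : config' d => val v x) @ w --> val w x.
    exact: (cvg_comp _ _ (cval w) (cproj (val w))).
  exact: (cx _ (discrete_set1 (val w x))).
have : \forall v \near w, forall y : S, val v (val y) = val w (val y).
  apply: (@filter_forall (config' d) S (fun y v => val v (val y) = val w (val y))
    (nbhs w) (nbhs_filter w)) => y; exact: near1.
by apply: (@filterS _ _ (nbhs_filter w)) => v vw x xS; exact: (vw [` xS]%fset).
Qed.

Lemma continuous_quasilocal (R : realType) (f : config' d -> R) :
  (forall e, 0 < e -> exists S, forall v w : config' d,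
     {in S, val v =1 val w} -> `|f v - f w| <= e) ->
  continuous f.
Proof.
move=> fS w; apply/(@cvgrPdist_le _ _ _ _ (nbhs_filter w)) => e e0.
have [S Sf] := fS e e0.
apply: (@filterS _ _ (nbhs_filter w)) (near_config'_agree S w) => v vw; apply: Sf => x xS.
by rewrite vw.
Qed.

End Regularity.

(** * Specifications from densities *)

(** [G L] is the density of a kernel on the patterns in [L], as a function of
    the whole configuration. In [density_approx], the function [g] is a
    conditional probability within the window [D]: the identity is required
    there exactly, while [G] is only close to [g]. This one condition gives
    measurability, quasilocality and the DLR equation. *)
Record conditional_densities (R : realType) d
    (mu' : probability (config' d) R)
    (G : {fset site d} -> config d -> R) : Prop := {
  density_ge0 : forall (L : {fset site d}) (eta : {ffun L -> bool}) (w : config' d),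
    0 <= G L (splice eta (val w)) ;
  density_out : forall (L : {fset site d}) (eta : {ffun L -> bool}) (w : config' d),
    nonisolates (splice eta (val w)) <> splice eta (val w) ->
    G L (splice eta (val w)) = 0 ;
  density_sum : forall (L : {fset site d}) (w : config' d),
    \sum_(eta : {ffun L -> bool}) G L (splice eta (val w)) = 1 ;
  density_chain : forall L D : {fset site d}, (L `<=` D)%fset ->
    forall w : config' d,
    G D (val w) =
    G L (val w) * \sum_(eta : {ffun L -> bool}) G D (splice eta (val w)) ;
  density_approx : forall (L : {fset site d}) e, 0 < e ->
    exists S : {fset site d}, forall D : {fset site d}, (S `<=` D)%fset ->
    exists g : config d -> R, [/\ local_on D g,
      (forall (eta : {ffun L -> bool}) (w : config' d),
         `|G L (splice eta (val w)) - g (splice eta (val w))| <= e) &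
      forall v : config d,
        fine (mu' [set s | {in D, val s =1 v}]) =
        g v * \sum_(eta : {ffun L -> bool})
                fine (mu' [set s | {in D, val s =1 splice eta v}])]
}.

Section Specification.
Context (R : realType) (d : nat) (mu' : probability (config' d) R).
Context (G : {fset site d} -> config d -> R) (hG : conditional_densities mu' G).
Implicit Types (L D S : {fset site d}) (w : config' d).

Let patch L (eta : {ffun L -> bool}) w : config' d :=
  nonisolates' (splice eta (val w)).

Let patch_val L (eta : {ffun L -> bool}) w :
  G L (splice eta (val w)) != 0 -> val (patch eta w) = splice eta (val w).
Proof.
move=> G0; have [//|/(density_out hG)] :=
  pselect (nonisolates (splice eta (val w)) = splice eta (val w)).
by move/eqP; rewrite (negbTE G0).
Qed.

Let pattern L k : {ffun L -> bool} := nth [ffun=> false] (enum {ffun L -> bool}) k.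

Let sum_pattern (V : nmodType) L (F : {ffun L -> bool} -> V) :
  \sum_(k < #|{ffun L -> bool}|) F (pattern L k) = \sum_eta F eta.
Proof.
rewrite -[RHS]big_enum /= (big_nth [ffun=> false]) -cardE big_mkord.
by apply: eq_bigr.
Qed.

(** The law of the spliced configuration. The projection to the non-isolates
    only serves to land in the range: it moves none of the atoms of positive
    mass. The absolute value makes the mass syntactically nonnegative. *)
Definition density_measure L (w : config'_out L) : {measure set config' d -> \bar R} :=
  msum (fun k => mscale (NngNum (normr_ge0 (G L (splice (pattern L k) (val w)))))
                   (dirac (patch (pattern L k) w))) #|{ffun L -> bool}|.
Arguments density_measure L w : clear implicits.

Let normG L (eta : {ffun L -> bool}) w :
  `|G L (splice eta (val w))| = G L (splice eta (val w)).
Proof. by rewrite ger0_norm// (density_ge0 hG). Qed.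

Lemma density_measureE L w A :
  density_measure L w A =
  (\sum_(eta : {ffun L -> bool})
     G L (splice eta (val w)) * \1_A (patch eta w))%:E.
Proof.
rewrite /density_measure /= /msum -sumEFin
  -(sum_pattern (fun eta => (G L (splice eta (val w)) * \1_A (patch eta w))%:E)).
apply: eq_bigr => k _; rewrite /= EFinM /mscale; congr (_ * _)%E.
exact: congr1 (normG _ _).
Qed.

Lemma integral_density_measure L w (f : config' d -> \bar R) :
  (forall v, 0 <= f v)%E -> measurable_fun setT f ->
  (\int[density_measure L w]_v f v =
   \sum_(eta : {ffun L -> bool}) (G L (splice eta (val w)))%:E * f (patch eta w))%E.
Proof.
move=> f0 mf; rewrite /density_measure ge0_integral_measure_sum//
  -(sum_pattern (fun eta => (G L (splice eta (val w)))%:E * f (patch eta w))%E).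
apply: eq_bigr => k _; rewrite ge0_integral_mscale// integral_dirac// diracT mul1e.
by congr (_%:E * _)%E; exact: normG.
Qed.

Let measurable_G L (eta : {ffun L -> bool}) :
  measurable_fun setT (fun w : config'_out L => G L (splice eta (val w))).
Proof.
have approx n : exists g : config d -> R, measurable_fun setT g /\
    forall w, `|G L (splice eta (val w)) - g (splice eta (val w))| <= n.+1%:R^-1.
  have n0 : 0 < n.+1%:R^-1 :> R by rewrite invr_gt0.
  have [S /(_ S (fsubset_refl S))[g [gS Gg _]]] := density_approx hG L n0.
  by exists g; split; [exact: measurable_local gS|exact: Gg].
have [g gP] := choice approx.
apply: (measurable_fun_cvg
  (fun n => measurableT_comp (proj1 (gP n)) (measurable_splice eta))).
move=> w _; apply/cvgrPdist_le => e e0; near=> n.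
apply: le_trans ((gP n).2 w) _; apply: ltW.
near: n; exact: near_infty_natSinv_lt (PosNum e0).
Unshelve. all: by end_near. Qed.

Let measurable_density L A : measurable A ->
  measurable_fun setT (fun w : config'_out L => density_measure L w A).
Proof.
move=> mA; apply: (eq_measurable_fun (fun w : config'_out L =>
    (\sum_(eta : {ffun L -> bool})
       G L (splice eta (val w)) * \1_A (patch eta w))%:E)).
  by move=> w _; rewrite density_measureE.
apply/measurable_EFinP.
apply: measurable_sum => eta; apply: measurable_funM; first exact: measurable_G.
apply: measurableT_comp; first exact: measurable_indic.
exact: (measurableT_comp (@measurable_nonisolates' d) (measurable_splice eta)).
Qed.

HB.instance Definition _ L :=
  isKernel.Build _ _ (config'_out L) (config' d) R (density_measure L)
    (@measurable_density L).

Let density_setT L (w : config'_out L) : (density_measure L w setT = 1)%E.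
Proof.
rewrite density_measureE -(density_sum hG L w); congr EFin.
by apply: eq_bigr => eta _; rewrite indicT mulr1.
Qed.

HB.instance Definition _ L :=
  Kernel_isProbability.Build _ _ (config'_out L) (config' d) R (density_measure L)
    (@density_setT L).

Definition density_kernel L : R.-pker (config'_out L) ~> (config' d) :=
  density_measure L.

Let density_event L w (P : set (config d)) :
  density_measure L w [set s | P (val s)] =
  (\sum_(eta : {ffun L -> bool})
     G L (splice eta (val w)) * \1_P (splice eta (val w)))%:E.
Proof.
rewrite density_measureE; congr EFin; apply: eq_bigr => eta _.
have [->|G0] := eqVneq (G L (splice eta (val w))) 0; first by rewrite !mul0r.
congr (_ * _); rewrite /indic; congr (_%:R : R); congr (nat_of_bool _).
have PE : P (val (patch eta w)) = P (splice eta (val w)) by rewrite patch_val.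
by apply/idP/idP => /set_mem h; apply/mem_set; move: h; rewrite /= -?PE.
Qed.

Let density_proper L w :
  density_measure L w [set s | forall x, x \notin L -> val s x = val w x] = 1%E.
Proof.
rewrite (density_event L w [set v | forall x, x \notin L -> v x = val w x]).
rewrite -(density_sum hG L w); congr EFin.
apply: eq_bigr => eta _; rewrite indicE mem_set ?mulr1// => x xL.
exact: splice_out.
Qed.

Let density_cylinder L w (eta : {ffun L -> bool}) :
  density_measure L w [set s | forall x : L, val s (val x) = eta x] =
  (G L (splice eta (val w)))%:E.
Proof.
rewrite (density_event L w [set v | forall x : L, v (val x) = eta x]).
rewrite (bigD1 eta)//= indicE mem_set ?mulr1; last by move=> x; exact: splice_val.
rewrite big1 ?addr0// => zeta /eqP zeta_eta; rewrite indicE memNset ?mulr0// => /= eq_eta.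
by apply: zeta_eta; apply/ffunP => x; rewrite -eq_eta splice_val.
Qed.

Let density_quasilocal L (eta : {ffun L -> bool}) :
  continuous (fun w : config' d => G L (splice eta (val w))).
Proof.
apply: continuous_quasilocal => e e0.
have e2 : 0 < e / 2 by rewrite divr_gt0.
have [S /(_ S (fsubset_refl S))[g [gS Gg _]]] := density_approx hG L e2.
exists S => v w vw; rewrite [leRHS]splitr.
have gvw : g (splice eta (val v)) = g (splice eta (val w)).
  exact/gS/splice_agree.
apply: le_trans (lerD (Gg eta v) (Gg eta w)).
by rewrite [X in _ <= _ + X]distrC gvw; apply: ler_distD.
Qed.

Let density_consistent L D : (L `<=` D)%fset ->
  forall w (A : set (config' d)), measurable A ->
  (\int[density_measure D w]_v density_measure L v A = density_measure D w A)%E.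
Proof.
move=> LD w A mA; rewrite integral_density_measure//; last first.
  exact: measurableT_comp (measurable_density mA) (@measurable_id_out d L).
pose T v : config' d := nonisolates' v.
pose F (v u : config d) := G D v * (G L u * \1_A (T u)).
transitivity (\sum_(zeta : {ffun D -> bool}) \sum_(eta : {ffun L -> bool})
    F (splice zeta (val w)) (splice eta (splice zeta (val w))))%:E.
  rewrite -sumEFin; apply: eq_bigr => zeta _.
  have [G0|G0] := eqVneq (G D (splice zeta (val w))) 0.
    by rewrite G0 mul0e big1// => eta _; rewrite /F G0 mul0r.
  rewrite density_measureE -EFinM mulr_sumr; congr EFin.
  by apply: eq_bigr => eta _; rewrite /F /patch patch_val.
rewrite splice_exchange// density_measureE; congr EFin.
apply: eq_bigr => zeta _; rewrite /patch -/(T _).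
have [fix_zeta|not_fix] :=
    pselect (nonisolates (splice zeta (val w)) = splice zeta (val w)).
  under eq_bigr do rewrite /F mulrA [G D _ * _]mulrC.
  rewrite -mulr_suml -mulr_sumr; congr (_ * _).
  have := density_chain hG LD (T (splice zeta (val w))).
  by rewrite /T /= fix_zeta.
rewrite (density_out hG)// mul0r big1// => eta _; rewrite /F.
have [->|G0] := eqVneq (G D (splice eta (splice zeta (val w)))) 0.
  by rewrite mul0r.
(* [zeta w] differs from a configuration without isolates only inside [L] *)
pose u := patch (restr D (splice eta (splice zeta (val w)))) w.
have spliceD : splice (restr D (splice eta (splice zeta (val w)))) (val w) =
    splice eta (splice zeta (val w)).
  apply: splice_restr => x xD; rewrite !splice_out//.
  by apply: contra xD; apply/fsubsetP.
have uE : val u = splice eta (splice zeta (val w)).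
  by rewrite /u patch_val spliceD.
have zetaE : splice (restr L (splice zeta (val w))) (val u) = splice zeta (val w).
  by apply: splice_restr => x xL; rewrite uE [RHS]splice_out.
by rewrite -zetaE (density_out hG) ?mul0r ?mulr0// zetaE.
Qed.


Let measurable_density' L A : measurable A ->
  measurable_fun setT (fun w : config' d => density_measure L w A).
Proof.
by move=> mA; exact: measurableT_comp (measurable_density mA) (@measurable_id_out d L).
Qed.

Definition density_mixture L (A : set (config' d)) : \bar R :=
  (\int[mu']_w density_measure L w A)%E.

Let density_mixture0 L : density_mixture L set0 = 0%E.
Proof. by apply: integral0_eq => w _; rewrite measure0. Qed.

Let density_mixture_ge0 L A : (0 <= density_mixture L A)%E.
Proof. exact: integral_ge0. Qed.

Let density_mixture_sigma_additive L : semi_sigma_additive (density_mixture L).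
Proof.
move=> F mF tF mUF; rewrite [X in _ --> X](_ : _ =
    (\sum_(n <oo) density_mixture L (F n))%E); last first.
  rewrite -integral_nneseries//; last by move=> n; exact: measurable_density'.
  by apply: eq_integral => w _; rewrite measure_semi_bigcup.
by apply: is_cvg_ereal_nneg_natsum.
Qed.

HB.instance Definition _ L := isMeasure.Build _ _ _ (density_mixture L)
  (density_mixture0 L) (density_mixture_ge0 L) (@density_mixture_sigma_additive L).

Let cylinder D (v : config d) := [set s : config' d | {in D, val s =1 v}].
Let u D v := fine (mu' (cylinder D v)).

Let measurable_event S (P : config d -> bool) :
  local_on S P -> measurable [set s : config' d | P (val s)].
Proof.
move=> /(measurable_local (V := bool)) mP.
have mPval := measurableT_comp mP (@measurable_config'_val d).
by have := mPval measurableT [set true]; rewrite setTI; apply.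
Qed.

Let measurable_cylinder D v : measurable (cylinder D v).
Proof.
rewrite (_ : cylinder D v = [set s : config' d | `[< {in D, val s =1 v} >]]).
  apply: (@measurable_event D (fun v' => `[< {in D, v' =1 v} >])) => w1 w2 w12.
  by apply/asboolP/asboolP => wv x xD; rewrite -wv// w12.
by apply/seteqP; split => s /= /asboolP.
Qed.

Let EFin_u D v : ((u D v)%:E = mu' (cylinder D v))%E.
Proof. by rewrite fineK// fin_num_measure. Qed.

Let u_ge0 D v : 0 <= u D v.
Proof. exact: fine_ge0. Qed.

Let bool0 : config d := fun=> false.

Let integral_local D (phi : config d -> R) : local_on D phi -> (forall v, 0 <= phi v) ->
  (\int[mu']_w (phi (val w))%:E)%E =
  (\sum_(b : {ffun D -> bool}) u D (splice b bool0) * phi (splice b bool0))%:E.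
Proof.
move=> phiD phi0.
transitivity (\int[mu']_w \sum_(b : {ffun D -> bool})
    (phi (splice b bool0))%:E * (\1_(cylinder D (splice b bool0)) w)%:E)%E.
  apply: eq_integral => w _; rewrite (bigD1 (restr D (val w)))//=.
  rewrite indicE mem_set ?mule1 ?big1 ?adde0.
  - by congr EFin; apply: phiD => x xD; rewrite splice_restr_in.
  - move=> b /eqP b_neq; rewrite indicE memNset ?mule0// => /= wb.
    by apply: b_neq; apply/ffunP => x; rewrite [RHS]ffunE wb ?splice_val// (valP x).
  - by move=> x xD; rewrite splice_restr_in.
have mind (b : {ffun D -> bool}) : measurable_fun setT (fun w : config' d =>
    (\1_(cylinder D (splice b bool0)) w : R)%:E).
  by apply/measurable_EFinP/measurable_indic; exact: measurable_cylinder.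
rewrite ge0_integral_sum//; last 2 first.
- by move=> b; apply: emeasurable_funM => //; exact: mind.
- by move=> b w _; rewrite mule_ge0 ?lee_fin// indicE ler0n.
rewrite -sumEFin; apply: eq_bigr => b _; rewrite (ge0_integralZl _ measurableT (mind b))//.
- by rewrite integral_indic// setIT mulrC EFinM EFin_u.
- by rewrite lee_fin.
Qed.

(** In a window that determines the event, the local approximation of the
    density satisfies the DLR equation exactly, by reversibility; letting the
    window grow removes the error of approximation. *)
Let density_mixture_local L S (P : config d -> bool) : local_on S P ->
  density_mixture L [set s | P (val s)] = mu' [set s | P (val s)].
Proof.
move=> PS; pose E := [set s : config' d | P (val s)].
have mE : measurable (E : set (config' d)) by exact: measurable_event PS.
rewrite -/E.
pose N : R := #|{ffun L -> bool}|%:R.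
have N0 : 0 < N.
  by rewrite ltr0n; apply/card_gt0P; exists [ffun=> false].
pose Gamma (w : config' d) := \sum_(eta : {ffun L -> bool})
  G L (splice eta (val w)) * (P (splice eta (val w)))%:R.
have GammaE w : density_measure L w E = (Gamma w)%:E.
  rewrite (density_event L w [set v | P v]); congr EFin; apply: eq_bigr => eta _.
  by rewrite indicE; congr (_ * (nat_of_bool _)%:R); apply/idP/idP; rewrite inE.
have approx e : 0 < e -> exists psi : config d -> R,
    [/\ measurable_fun setT (fun w : config' d => (psi (val w))%:E),
        forall v, 0 <= psi v,
        forall w : config' d, `|Gamma w - psi (val w)| <= e &
        (\int[mu']_w (psi (val w))%:E = mu' E)%E].
  move=> e0; have eN0 : 0 < e / N by rewrite divr_gt0.
  have [S1 /(_ (S1 `|` (S `|` L))%fset (fsubsetUl _ _))] := density_approx hG L eN0.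
  set D := (S1 `|` _)%fset => -[g [gD Gg gu]].
  have LD : (L `<=` D)%fset by rewrite /D fsetUA fsubsetUr.
  have SD : (S `<=` D)%fset.
    by rewrite /D; apply: fsubset_trans (fsubsetUr _ _); exact: fsubsetUl.
  pose psi v := \sum_(eta : {ffun L -> bool})
    `|g (splice eta v)| * (P (splice eta v))%:R.
  have psiD : local_on D psi.
    move=> v w vw; apply: eq_bigr => eta _.
    have etavw := splice_agree eta vw.
    by rewrite (gD _ _ etavw) (local_on_sub SD PS etavw).
  have psi0 v : 0 <= psi v by apply: sumr_ge0 => eta _; rewrite mulr_ge0.
  exists psi; split=> //.
  - apply/measurable_EFinP; exact: measurableT_comp (measurable_local psiD)
      (@measurable_config'_val d).
  - move=> w; rewrite /Gamma /psi -sumrB; apply: le_trans (ler_norm_sum _ _ _) _.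
    apply: le_trans (_ : \sum_(eta : {ffun L -> bool}) e / N <= _).
      apply: ler_sum => eta _; rewrite -mulrBl normrM [X in _ * X]ger0_norm//.
      apply: le_trans (_ : `|G L (splice eta (val w)) - `|g (splice eta (val w))| | * 1 <= _).
        by rewrite ler_wpM2l// lern1 leq_b1.
      rewrite mulr1; apply: le_trans (Gg eta w).
      by rewrite -[X in `|X - _|]ger0_norm ?(density_ge0 hG)//; exact: ler_dist_dist.
    by rewrite sumr_const -[leLHS]mulr_natr -/N mulfVK ?gt_eqF.
  rewrite (integral_local psiD)//.
  have gu' v : u D v = `|g v| * \sum_(eta : {ffun L -> bool}) u D (splice eta v).
    rewrite -[LHS](ger0_norm (u_ge0 _ _)) {1}/u gu normrM [X in _ * X]ger0_norm//.
    by apply: sumr_ge0 => eta _; exact: u_ge0.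
  transitivity (\sum_(b : {ffun D -> bool})
      u D (splice b bool0) * (P (splice b bool0))%:R)%:E.
    congr EFin; under eq_bigr do rewrite mulr_sumr.
    rewrite (splice_exchange (fun v v' => u D v * (`|g v'| * (P v')%:R)))//.
    apply: eq_bigr => b _; rewrite [in RHS]gu' mulrAC mulr_sumr.
    by apply: eq_bigr => eta _; ring.
  have PD : local_on D (fun v => (P v)%:R : R).
    by move=> v w vw; rewrite (local_on_sub SD PS vw).
  rewrite -(integral_local PD); last by move=> v; exact: ler0n.
  rewrite -[E in RHS]setIT -integral_indic//; apply: eq_integral => w _.
  by rewrite indicE; congr EFin; congr (nat_of_bool _)%:R; apply/idP/idP; rewrite inE.
have mGamma : measurable_fun setT (fun w => (Gamma w)%:E).
  apply: (eq_measurable_fun (fun w : config' d => density_measure L w E)).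
    by move=> w _; exact: GammaE.
  exact: measurable_density'.
have Gamma0 w : (0 <= (Gamma w)%:E)%E by rewrite -GammaE.
have -> : density_mixture L E = (\int[mu']_w (Gamma w)%:E)%E.
  by apply: eq_integral => w _; exact: GammaE.
have mu'1 e : (\int[mu']_w (cst e%:E w) = e%:E)%E.
  rewrite integral_cst// -[RHS]mule1; congr (_ * _)%E; exact: probability_setT.
apply/eqP; rewrite eq_le; apply/andP; split; apply/lee_addgt0Pr => e e0;
    have [psi [mpsi psi0 Gpsi psiE]] := approx e e0; rewrite -(mu'1 e).
- rewrite -psiE -ge0_integralD//; last 2 first.
    by move=> w _; rewrite lee_fin.
    by move=> w _; rewrite lee_fin ltW.
  apply: ge0_le_integral => //.
  + exact: emeasurable_funD.
  + move=> w _; rewrite -EFinD lee_fin -lerBlDl.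
    exact: le_trans (ler_norm _) (Gpsi w).
- rewrite -psiE -ge0_integralD//; last by move=> w _; rewrite lee_fin ltW.
  apply: ge0_le_integral => //.
  + by move=> w _; rewrite lee_fin.
  + exact: emeasurable_funD.
  + move=> w _; rewrite -EFinD lee_fin -lerBlDl.
    by apply: le_trans (ler_norm _) _; rewrite distrC.
Qed.

Let density_dlr L A : measurable A -> density_mixture L A = mu' A.
Proof.
pose events := [set [set s : config' d | P (val s)] |
  P in [set P : config d -> bool | exists S, local_on S P]].
have eventsI : setI_closed events.
  move=> _ _ [P [S PS] <-] [Q [S' QS'] <-]; exists (fun v => P v && Q v).
    exists (S `|` S')%fset => v w vw.
    by congr andb; [apply: PS|apply: QS'] => x xS; apply: vw; rewrite inE xS ?orbT.
  by apply/seteqP; split => s /=; [move=> /andP|move=> [-> ->]].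
have eventsT : events setT.
  by exists (fun=> true) => //; [exists fset0|apply/seteqP].
move=> mA; apply: (measure_unique events (fun=> setT)) => //.
- apply/seteqP; split.
    apply: smallest_sub; first exact: smallest_sigma_algebra.
    move=> _ [x _ [B mB <-]]; apply: sub_sigma_algebra; rewrite setTI.
    exists (fun v => v x \in B); last by apply/seteqP; split => s /=; rewrite inE.
    by exists [fset x]%fset => v w vw; rewrite vw ?inE.
  apply: smallest_sub; first exact: sigma_algebra_measurable.
  by move=> _ [P [S PS] <-]; exact: measurable_event PS.
- by rewrite bigcup_const//; exists 0%N.
- by move=> _ [P [S PS] <-]; exact: density_mixture_local PS.
- move=> n; have ET : [set: config' d] = [set s : config' d | true] by apply/seteqP.
  have mT : density_mixture L [set: config' d] = mu' [set: config' d].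
    by rewrite ET; exact: (@density_mixture_local L fset0 (fun=> true)).
  have : (density_mixture L [set: config' d] < +oo)%E.
    by rewrite mT (le_lt_trans (probability_le1 _ _)) ?ltry.
  exact.
Qed.

Definition density_specification : specification R d :=
  @Specification R d density_kernel density_proper density_consistent.

Theorem specification_of_densities :
  exists gamma : specification R d, quasilocal gamma /\ specification_for gamma mu'.
Proof.
exists density_specification; split; last exact: density_dlr.
move=> L eta; rewrite (_ : (fun w => _) = EFin \o (fun w => G L (splice eta (val w)))).
  move=> w; apply: (@cvg_EFin _ _ _ (nbhs_filter w)).
    exact: (@filterE _ _ (nbhs_filter w)).
  exact: density_quasilocal.
by apply/funext => w; exact: density_cylinder.
Qed.

End Specification.

(** * Local events of the Bernoulli field *)

Section BernoulliField.
Context (R : realType) (d : nat) (p : R).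
Context (mu : probability (config d) R) (hmu : bernoulli_product p mu).
Implicit Types (S D : {fset site d}) (v w : config d) (x y : site d).
Implicit Types (f g : config d -> bool) (s : seq (site d)).

Definition prob_event f : R := fine (mu [set w | f w]).

Lemma measurable_local_event S f : local_on S f -> measurable [set w | f w].
Proof.
move=> /(measurable_local (V := bool)) mf.
by have := mf measurableT [set true]; rewrite setTI; apply.
Qed.

Lemma prob_event_ge0 f : 0 <= prob_event f.
Proof. exact: fine_ge0. Qed.

Lemma EFin_prob_event S f : local_on S f -> (prob_event f)%:E = mu [set w | f w].
Proof.
by move=> fS; rewrite fineK// fin_num_measure//; exact: measurable_local_event fS.
Qed.

Lemma local_on_and S D f g : local_on S f -> local_on D g ->
  local_on (S `|` D)%fset (fun w => f w && g w).
Proof.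
move=> fS gD v w vw; congr andb; [apply: fS|apply: gD] => x xS; apply: vw.
  by rewrite inE xS.
by rewrite inE xS orbT.
Qed.

Lemma local_on_neg S f : local_on S f -> local_on S (fun w => ~~ f w).
Proof. by move=> fS v w vw; rewrite (fS v w). Qed.

Lemma local_on_site x : local_on [fset x]%fset (fun w => w x).
Proof. by move=> v w; apply; rewrite inE. Qed.

Lemma prob_event_mono S D f g : local_on S f -> local_on D g ->
  (forall w, f w -> g w) -> prob_event f <= prob_event g.
Proof.
move=> fS gD fg; rewrite -lee_fin (EFin_prob_event fS) (EFin_prob_event gD).
apply: le_measure; rewrite ?inE; [exact: measurable_local_event fS|
  exact: measurable_local_event gD|exact: fg].
Qed.

Lemma prob_event_split S D f g : local_on S f -> local_on D g ->
  prob_event f = prob_event (fun w => f w && g w) +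
                 prob_event (fun w => f w && ~~ g w).
Proof.
move=> fS gD; apply: EFin_inj; rewrite EFinD (EFin_prob_event fS).
have fgS := local_on_and fS gD; have fngS := local_on_and fS (local_on_neg gD).
rewrite (EFin_prob_event fgS) (EFin_prob_event fngS).
rewrite -measureU; last 3 first.
- exact: measurable_local_event fgS.
- exact: measurable_local_event fngS.
- by apply/seteqP; split => w //= [/andP[_ gw] /andP[_]]; rewrite gw.
congr (mu _); apply/seteqP; split => w /=.
  by move=> fw; case gw : (g w); [left|right]; rewrite fw.
by move=> [|] /andP[].
Qed.

Lemma prob_event_agree S v :
  prob_event (fun w => all (fun x => w x == v x) S) =
  \prod_(x <- S) bernoulli_pmf p (v x).
Proof.
have := hmu (restr S v).
rewrite (eq_bigr (fun y : S => bernoulli_pmf p (v (val y)))); last first.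
  by move=> y _; rewrite ffunE.
rewrite -(big_seq_fsetE _ S predT (fun x => bernoulli_pmf p (v x))) /=.
move=> muE; apply: EFin_inj; rewrite -muE /prob_event.
rewrite (_ : [set w | _] = [set w : config d | forall x : S, w (val x) = restr S v x]).
  by rewrite fineK// muE.
apply/seteqP; split => w /=.
  by move=> /allP wv x; rewrite ffunE; apply/eqP/wv/valP.
by move=> wv; apply/allP => x xS; rewrite (wv [` xS]%fset) ffunE.
Qed.

Lemma local_on_agree S v : local_on S (fun w => all (fun x => w x == v x) S).
Proof. by move=> w w' ww'; apply: eq_in_all => x xS; rewrite ww'. Qed.

(** The event is a disjoint union of cylinders on [S], and the product formula
    applies to each of them. *)
Lemma prob_event_site S f x b : local_on S f -> x \notin S ->
  prob_event (fun w => f w && (w x == b)) = bernoulli_pmf p b * prob_event f.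
Proof.
move=> fS xS; pose fill (eta : {ffun S -> bool}) : config d := splice eta (fun=> b).
pose C (eta : {ffun S -> bool}) (w : config d) := all (fun y => w y == fill eta y) S.
pose Cb eta w := all (fun y => w y == fill eta y) (x |` S)%fset.
have CbE eta w : Cb eta w = (w x == b) && C eta w.
  have fx : fill eta x = b by rewrite /fill splice_out.
  apply/allP/andP => [Cw|[wx /allP Cw] y].
    split; first by rewrite -fx Cw// !inE eqxx.
    by apply/allP => y yS; rewrite Cw// !inE yS orbT.
  by rewrite !inE => /orP[/eqP->|/Cw//]; rewrite fx.
have muCb eta : mu [set w | Cb eta w] = ((bernoulli_pmf p b)%:E * mu [set w | C eta w])%E.
  rewrite -(EFin_prob_event (@local_on_agree (x |` S)%fset (fill eta))).
  rewrite -(EFin_prob_event (@local_on_agree S (fill eta))) -EFinM !prob_event_agree.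
  by rewrite big_fsetU1//= {1}/fill splice_out.
pose I := [set eta | f (fill eta)].
have C_restr w : C (restr S w) w.
  by apply/allP => y yS; rewrite /fill splice_restr_in.
have C_eq eta w : C eta w -> eta = restr S w.
  move=> /allP Cw; apply/ffunP => y; rewrite ffunE.
  by rewrite (eqP (Cw _ (valP y))) /fill splice_val.
have fE eta w : C eta w -> f w = f (fill eta).
  by move=> /allP Cw; apply: fS => y yS; exact/eqP/Cw.
have trivC (E : {ffun S -> bool} -> config d -> bool) :
    (forall eta w, E eta w -> C eta w) -> trivIset I (fun eta => [set w | E eta w]).
  move=> EC eta zeta _ _ [w [/= /EC/C_eq -> /EC/C_eq ->]] //.
have mC eta : measurable [set w | C eta w].
  exact: measurable_local_event (@local_on_agree _ _).
have mCb eta : measurable [set w | Cb eta w].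
  exact: measurable_local_event (@local_on_agree _ _).
apply: EFin_inj; rewrite EFinM (EFin_prob_event fS).
rewrite (EFin_prob_event (S := (S `|` [fset x])%fset)); last first.
  apply: local_on_and => // v w vw.
  by rewrite (local_on_site vw).
rewrite (_ : [set w | f w] = \bigcup_(eta in I) [set w | C eta w]); last first.
  apply/seteqP; split => w /=; last by move=> [eta Ieta Cw]; rewrite (fE eta _ Cw).
  move=> fw; exists (restr S w) => //=.
  exact: etrans (esym (fE _ _ (C_restr w))) fw.
rewrite (_ : [set w | _ && _] = \bigcup_(eta in I) [set w | Cb eta w]); last first.
  apply/seteqP; split => w /=.
    move=> /andP[fw wx]; exists (restr S w); last by rewrite /= CbE wx C_restr.
    exact: etrans (esym (fE _ _ (C_restr w))) fw.
  move=> [eta Ieta]; rewrite /mkset CbE => /andP[-> Cw].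
  by rewrite andbT (fE eta _ Cw).
rewrite !measure_fin_bigcup//; try exact: finite_finset; last 2 first.
- exact: trivC.
- by apply: trivC => eta w; rewrite CbE => /andP[].
rewrite ge0_mule_fsumr//; apply: eq_fsbigr => eta _; exact: muCb.
Qed.

End BernoulliField.

(** * Void probabilities given the visible configuration *)

Section Windows.
Context (d : nat).
Implicit Types (D : {fset site d}) (sigma v w : config d) (x y : site d).
Implicit Types (s : seq (site d)).

Definition nbhd D : {fset site d} :=
  [fset y in (D : seq _) ++ flatten [seq (boundary x : seq _) | x <- D]]%fset.

Lemma nbhdP D y :
  reflect (y \in D \/ exists2 x, x \in D & y \in boundary x) (y \in nbhd D).
Proof.
rewrite !inE; apply: (iffP orP) => -[yD|]; [by left| |by left|].
  by move=> /flattenP[_ /mapP[x xD ->] yx]; right; exists x.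
move=> [x xD yx]; right; apply/flattenP; exists (boundary x : seq _) => //.
exact: map_f.
Qed.

Lemma sub_nbhd D : (D `<=` nbhd D)%fset.
Proof. by apply/fsubsetP => x xD; apply/nbhdP; left. Qed.

Lemma boundary_nbhd D x y : x \in D -> y \in boundary x -> y \in nbhd D.
Proof. by move=> xD yx; apply/nbhdP; right; exists x. Qed.

Lemma nonisolates_local v w x :
  v x = w x -> {in boundary x, v =1 w} -> nonisolates v x = nonisolates w x.
Proof. by move=> vwx vw; rewrite !nonisolatesE vwx; congr andb; exact: eq_in_has. Qed.

Definition visible D sigma w : bool := all (fun x => nonisolates w x == sigma x) D.

Definition vacant s w : bool := all (fun x => ~~ w x) s.

Lemma local_on_visible D sigma : local_on (nbhd D) (visible D sigma).
Proof.
move=> v w vw; apply: eq_in_all => x xD; rewrite (@nonisolates_local v w)//.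
  by apply: vw; apply/nbhdP; left.
by move=> y yx; apply: vw; exact: boundary_nbhd yx.
Qed.

Lemma local_on_vacant s : local_on [fset x in s]%fset (vacant s).
Proof. by move=> v w vw; apply: eq_in_all => x xs; rewrite vw// inE. Qed.

Definition set_site w x (b : bool) : config d := fun y => if y == x then b else w y.

Lemma notin_boundary x : x \notin boundary x.
Proof.
apply/negP; rewrite /boundary => /fsetUP[] /imfsetP[i _];
  move/eqP; rewrite -[X in X == _]addr0 (inj_eq (addrI _)) 1?eq_sym ?oppr_eq0;
  by move=> /eqP/ffunP/(_ i); rewrite !ffunE eqxx.
Qed.

(** The invisible particles can thus be removed one by one; they interact only
    through their exclusion of occupied neighbours. *)
Lemma nonisolates_set_site w x b :
  vacant (boundary x) w -> nonisolates (set_site w x b) = nonisolates w.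
Proof.
move=> /allP vac; apply/funext => y; have [->|yx] := eqVneq y x.
  have no v : {in boundary x, v =1 w} -> nonisolates v x = false.
    move=> vw; apply/negP; rewrite nonisolatesE => /andP[_ /hasP[z zx]].
    by rewrite vw//; apply/negP/vac.
  rewrite !no// => z zx; rewrite /set_site; case: eqP => // zEx.
  by move: zx; rewrite zEx (negbTE (notin_boundary x)).
have [ybd|ybd] := boolP (y \in boundary x).
  have wy : w y = false by apply/negbTE/vac.
  by rewrite !nonisolatesE {1}/set_site (negbTE yx) wy.
apply: nonisolates_local; first by rewrite /set_site (negbTE yx).
move=> z zy; rewrite /set_site; case: eqP => // zx.
by move: ybd; rewrite boundaryC -zx zy.
Qed.

End Windows.

Section VoidProbability.
Context (R : realType) (d : nat) (p : R) (hp0 : 0 < p) (hp1 : p < 1).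
Context (mu : probability (config d) R) (hmu : bernoulli_product p mu).
Implicit Types (D : {fset site d}) (sigma v w : config d) (x y : site d).
Implicit Types (s : seq (site d)).

(** As a function of [s], this is up to normalisation the partition function of
    the hard-core gas on the invisible sites outside [s]. *)
Definition void_prob D sigma s : R :=
  prob_event mu (fun w => visible D sigma w && vacant s w).

Lemma distribution_visible D v :
  fine (distribution mu (@nonisolates' d) [set s | {in D, val s =1 v}]) =
  void_prob D v [::].
Proof.
rewrite /void_prob /prob_event; congr (fine (mu _)); apply/seteqP.
split => w /=; rewrite andbT; first by move=> wv; apply/allP => x /wv/eqP.
by move=> /allP wv x /wv/eqP.
Qed.

Lemma local_on_void D sigma s :
  local_on (nbhd D `|` [fset x in s])%fset (fun w => visible D sigma w && vacant s w).
Proof. exact: local_on_and (@local_on_visible _ _ _) (@local_on_vacant _ _). Qed.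

Lemma void_prob_ge0 D sigma s : 0 <= void_prob D sigma s.
Proof. exact: prob_event_ge0. Qed.

Lemma eq_mem_void_prob D sigma s t : s =i t -> void_prob D sigma s = void_prob D sigma t.
Proof.
move=> st; rewrite /void_prob; congr prob_event; apply/funext => w.
by rewrite /vacant (eq_all_r st).
Qed.

Lemma void_prob_mem D sigma s x :
  x \in s -> void_prob D sigma (x :: s) = void_prob D sigma s.
Proof.
move=> xs; apply: eq_mem_void_prob => y; rewrite inE.
by case: eqP => // ->.
Qed.

Lemma void_prob_gt0 D sigma s :
  nonisolates sigma = sigma -> vacant s sigma -> 0 < void_prob D sigma s.
Proof.
move=> fix_sigma vac; pose S := (nbhd D `|` [fset x in s])%fset.
apply: lt_le_trans (_ : prob_event mu (fun w => all (fun x => w x == sigma x) S) <= _).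
  rewrite (prob_event_agree hmu) big_seq; apply: prodr_gt0 => x _.
  by rewrite /bernoulli_pmf; case: ifP; rewrite ?subr_gt0.
apply: prob_event_mono; [exact: local_on_agree|exact: local_on_void|].
move=> w /allP wS; rewrite (@local_on_void D sigma s w sigma); last by move=> x /wS/eqP.
by rewrite vac andbT /visible fix_sigma; apply/allP => x _.
Qed.

(** The recursion of the hard-core gas: an occupied site that is seen as empty
    has no occupied neighbour, and then emptying it changes nothing visible. *)
Lemma void_prob_rec D sigma s x : x \in D -> sigma x = false -> x \notin s ->
  void_prob D sigma s = void_prob D sigma (x :: s) +
    p / (1 - p) * void_prob D sigma (catrev (boundary x) (x :: s)).
Proof.
move=> xD sx xs; have q0 : 1 - p != 0 by rewrite gt_eqF// subr_gt0.
(* the configurations in which [x] could be occupied or empty alike *)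
pose H w := visible D sigma w && vacant (boundary x ++ s) w.
pose S := ((nbhd D `|` [fset y in (boundary x : seq _) ++ s]) `\ x)%fset.
have H_set w b : H (set_site w x b) = H w.
  have vacE : vacant (boundary x ++ s) (set_site w x b) = vacant (boundary x ++ s) w.
    apply: eq_in_all => y; rewrite mem_cat => ybd; rewrite /set_site.
    by case: eqP ybd => // ->; rewrite (negbTE (notin_boundary x)) (negbTE xs).
  rewrite /H vacE; case vac : (vacant (boundary x ++ s) w); rewrite ?andbF// !andbT.
  rewrite /visible nonisolates_set_site//.
  by move: vac; rewrite /vacant all_cat => /andP[].
have HS : local_on S H.
  move=> v w vw; rewrite -(H_set v false) -(H_set w false).
  apply: (@local_on_void D sigma (boundary x ++ s)) => y yS; rewrite /set_site.
  by case: eqP => // /eqP yx; apply: vw; rewrite !inE yx; move: yS; rewrite !inE.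
have xS : x \notin S by rewrite !inE eqxx.
have Ht := prob_event_site hmu true HS xS.
have Hf := prob_event_site hmu false HS xS.
rewrite {1}/void_prob.
rewrite (prob_event_split _ (@local_on_void D sigma s) (@local_on_site _ x)).
rewrite addrC; congr (_ + _).
  by congr prob_event; apply/funext => w; rewrite /vacant /= -andbA [X in _ && X]andbC.
rewrite (_ : void_prob D sigma (catrev _ _) = (1 - p) * prob_event mu H); last first.
  rewrite -[1 - p]/(bernoulli_pmf p false) -Hf; congr prob_event; apply/funext => w.
  rewrite /H eqbF_neg -andbA; congr andb; rewrite /vacant catrevE.
  rewrite all_cat all_rev all_cat /= -!andbA; congr andb; exact: andbC.
rewrite mulrA mulfVK// -[p in RHS]/(bernoulli_pmf p true) -Ht.
congr prob_event; apply/funext => w; rewrite /H eqb_id.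
have [wx|] := boolP (w x); rewrite ?andbF// !andbT /vacant all_cat.
case vis : (visible D sigma w) => //=.
suff -> : all (fun y => ~~ w y) (boundary x) by [].
apply/allP => y yx; apply/negP => wy.
by move/allP: vis => /(_ _ xD); rewrite sx (nonisolates_pair wx wy yx).
Qed.

End VoidProbability.

(** * Contraction of the hard-core recursion *)

(** The difference quotient is largest when [a] and [b] equal [1 - p] and
    [M = 1]; it is then [p / ((1 - p) (1 + p) ^ 2)], which is at most [p] because
    [(1 - p) (1 + p) ^ 2 = 1 + p (1 - p - p ^ 2)]. *)
Lemma hardcore_lipschitz (R : realFieldType) (p M a b : R) :
    0 < p -> p <= 2^-1 -> 0 <= M <= 1 -> 1 - p <= a <= 1 -> 1 - p <= b <= 1 ->
  `|(1 + p / (1 - p) * (M * a))^-1 - (1 + p / (1 - p) * (M * b))^-1| <= p * `|a - b|.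
Proof.
move=> p0 p2 /andP[M0 M1] /andP[a0 a1] /andP[b0 b1].
have q0 : 0 < 1 - p by lra.
have lamM c : 1 - p <= c -> 1 + p * M <= 1 + p / (1 - p) * (M * c).
  move=> c0; rewrite lerD2l mulrAC ler_pdivlMr//.
  by rewrite -[leLHS]mulrA ler_pM2l// ler_wpM2l.
have [la lb] := (lamM _ a0, lamM _ b0).
set A := 1 + _ * (M * a) in la *; set B := 1 + _ * (M * b) in lb *.
have pM0 : 0 <= p * M by rewrite mulr_ge0// ltW.
have A0 : 0 < A by lra.
have B0 : 0 < B by lra.
have -> : A^-1 - B^-1 = p * (b - a) * (M / ((1 - p) * A * B)).
  have BA : B - A = p / (1 - p) * (M * (b - a)) by rewrite /A /B; ring.
  have -> : A^-1 - B^-1 = (B - A) / (A * B) by field; rewrite !gt_eqF.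
  by rewrite BA; field; rewrite !gt_eqF.
rewrite normrM [X in X * _]normrM (gtr0_norm p0) distrC -[leRHS]mulr1.
apply: ler_wpM2l; first by rewrite mulr_ge0// ltW.
have den0 : 0 < (1 - p) * A * B by rewrite !mulr_gt0.
rewrite ger0_norm ?divr_ge0 ?(ltW den0)// ler_pdivrMr// mul1r.
apply: le_trans (_ : (1 - p) * ((1 + p * M) * (1 + p * M)) <= _); last first.
  by rewrite -mulrA ler_pM2l// ler_pM//; lra.
(* the value at M = 1, plus a multiple of 1 - M *)
rewrite -subr_ge0.
have -> : (1 - p) * ((1 + p * M) * (1 + p * M)) - M =
    p * (1 - p - p * p) + (1 - M) * (1 - (1 - p) * (2 * p + p * p * (1 + M))) by ring.
apply: addr_ge0; first by apply: mulr_ge0; nra.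
apply: mulr_ge0; first lra.
have : (1 - p) * (2 * p + p * p * (1 + M)) <= (1 - p) * (2 * p + p * p * 2).
  by rewrite ler_pM2l// lerD2l; apply: ler_wpM2l; nra.
have : (1 - p) * (2 * p + p * p * 2) <= 1 by nra.
lra.
Qed.

Section Contraction.
Context (R : realType) (d : nat) (p : R) (hd : (1 <= d)%N).
Context (hp0 : 0 < p) (hp : p < (2 * d)%:R^-1).
Context (mu : probability (config d) R) (hmu : bernoulli_product p mu).
Context (sigma : config d) (fix_sigma : nonisolates sigma = sigma).
Implicit Types (D : {fset site d}) (x y : site d) (s ys : seq (site d)).

Let lam : R := p / (1 - p).
Let Q D s := void_prob mu D sigma s.

Let d2_gt0 : 0 < (2 * d)%:R :> R.
Proof. by rewrite ltr0n muln_gt0. Qed.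

Let p_half : p <= 2^-1.
Proof.
apply: le_trans (ltW hp) _; rewrite lef_pV2 ?posrE// ler_nat.
exact: leq_pmulr.
Qed.

Let p1 : p < 1. Proof. by have := p_half; lra. Qed.

Let lam_gt0 : 0 < lam. Proof. by rewrite divr_gt0// subr_gt0. Qed.

Let Q_gt0 D s : vacant s sigma -> 0 < Q D s.
Proof. exact: (void_prob_gt0 hp0 p1 hmu). Qed.

(** Conditional probability that all of [ys] is empty, given that [s] is. *)
Let ratio D s ys := Q D (catrev ys s) / Q D s.

Let ratio_nil D s : vacant s sigma -> ratio D s [::] = 1.
Proof. by move=> vac; rewrite /ratio divff// gt_eqF// Q_gt0. Qed.

Let ratio_cons D s y ys : vacant (y :: s) sigma ->
  ratio D s (y :: ys) = ratio D s [:: y] * ratio D (y :: s) ys.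
Proof.
move=> vac; rewrite /ratio /= [RHS]mulrC mulrA mulfVK// gt_eqF//.
exact: Q_gt0.
Qed.

Let ratio_ge0 D s ys : 0 <= ratio D s ys.
Proof. by rewrite divr_ge0// void_prob_ge0. Qed.

Let ratio1_mem D s x : x \in s -> vacant s sigma -> ratio D s [:: x] = 1.
Proof.
by move=> xs vac; rewrite /ratio /Q /= void_prob_mem// divff// gt_eqF// Q_gt0.
Qed.

Let ratio1_rec D s x : x \in D -> sigma x = false -> x \notin s ->
  vacant s sigma ->
  ratio D s [:: x] = (1 + lam * ratio D (x :: s) (boundary x))^-1.
Proof.
move=> xD sx xs vac.
have Qx : Q D (x :: s) != 0 by rewrite gt_eqF// Q_gt0// /vacant /= sx.
rewrite /ratio /= -[LHS]invrK invf_div; congr (_^-1).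
rewrite {1}/Q (void_prob_rec p1 hmu xD sx xs) -/lam mulrDl divff//.
by rewrite mulrA.
Qed.

Let ratio_le1 D s ys : vacant s sigma -> ratio D s ys <= 1.
Proof.
move=> vac; rewrite ler_pdivrMr ?Q_gt0// mul1r.
apply: prob_event_mono; [exact: local_on_void|exact: local_on_void|].
move=> w /andP[-> /allP vacw]; rewrite andTb; apply/allP => x xs; apply: vacw.
by rewrite catrevE mem_cat xs orbT.
Qed.

(** The conditional odds of occupation are at most those of a free site. *)
Let ratio1_ge D s x : x \in D -> sigma x = false -> vacant s sigma ->
  1 - p <= ratio D s [:: x].
Proof.
move=> xD sx vac; have vacx : vacant (x :: s) sigma by rewrite /= sx.
have [xs|xs] := boolP (x \in s); first by rewrite ratio1_mem// lerBlDr lerDl ltW.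
have q0 : 0 < 1 - p by rewrite subr_gt0 p1.
have r0 : 0 < 1 + lam * ratio D (x :: s) (boundary x).
  by rewrite ltr_wpDr// mulr_ge0 ?ratio_ge0// ltW.
rewrite ratio1_rec// -[1 - p]invrK lef_pV2 ?posrE ?invr_gt0//.
have -> : (1 - p)^-1 = 1 + lam by rewrite /lam; field; rewrite gt_eqF.
rewrite lerD2l -[leRHS]mulr1 ler_pM2l//.
exact: ratio_le1.
Qed.

Let ratio1_visible D s x y : x \in D -> y \in D -> sigma x = false ->
    y \in boundary x -> sigma y -> vacant s sigma ->
  ratio D s [:: x] = 1.
Proof.
move=> xD yD sx ybd sy vac.
have [xs|xs] := boolP (x \in s); first by rewrite ratio1_mem.
rewrite ratio1_rec// (_ : ratio _ _ _ = 0) ?mulr0 ?addr0 ?invr1//.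
rewrite /ratio (_ : Q _ _ = 0) ?mul0r// /Q /void_prob /prob_event.
rewrite (_ : [set w | _] = set0) ?measure0//; apply/seteqP; split => w //=.
move=> /andP[/allP vis /allP vacw].
have /vacw/negP : y \in catrev (boundary x) (x :: s).
  by rewrite catrevE mem_cat mem_rev ybd.
by apply; apply: nonisolates_sub; rewrite (eqP (vis _ yD)).
Qed.

(** One step of the recursion, changing the factors of the product over [ys]
    one at a time; [M] collects the factors already treated. *)
Let ratio_recip_dist D D' ys e s (M : R) :
    (forall y, y \in ys -> [/\ y \in D, y \in D' & sigma y = false]) ->
    (forall y t, y \in ys -> vacant t sigma ->
       `|ratio D t [:: y] - ratio D' t [:: y]| <= e) ->
    vacant s sigma -> 0 <= M <= 1 ->
  `|(1 + lam * (M * ratio D s ys))^-1 - (1 + lam * (M * ratio D' s ys))^-1|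
  <= p * (e *+ size ys).
Proof.
elim: ys s M => [|y ys IH] s M ysD close vac /andP[M0 M1].
  by rewrite !ratio_nil// subrr normr0 mulr0.
have yin : y \in y :: ys by rewrite mem_head.
have [yD yD' sy] := ysD y yin.
have vacy : vacant (y :: s) sigma by rewrite /= sy.
rewrite (@ratio_cons D _ _ _ vacy) (@ratio_cons D' _ _ _ vacy) mulrS mulrDr.
have := close y s yin vac.
have := ratio1_ge yD sy vac; have := ratio1_ge yD' sy vac.
have := ratio_le1 D [:: y] vac; have := ratio_le1 D' [:: y] vac.
move: (ratio D s [:: y]) (ratio D' s [:: y]) => a b b1 a1 b0 a0 ab.
have := ratio_le1 D ys vacy; have := ratio_ge0 D (y :: s) ys.
have IHy (N : R) := IH (y :: s) N.
move: (ratio D (y :: s) ys) (ratio D' (y :: s) ys) IHy => r r' IHy r0 r1.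
apply: le_trans (ler_distD ((1 + lam * (M * (b * r)))^-1) _ _) _; apply: lerD.
  rewrite ![M * (_ * r)]mulrCA ![_ * (M * r)]mulrC.
  apply: le_trans (hardcore_lipschitz hp0 p_half _ _ _) _.
  - by rewrite mulr_ge0//= mulr_ile1.
  - by rewrite a0.
  - by rewrite b0.
  - by rewrite ler_pM2l.
rewrite !(mulrA M).
apply: IHy => //.
- by move=> z zys; apply: ysD; rewrite inE zys orbT.
- by move=> z t zys; apply: close; rewrite inE zys orbT.
- have b00 : 0 <= b by apply: le_trans b0; rewrite subr_ge0 ltW// p1.
  by rewrite mulr_ge0//= mulr_ile1.
Qed.

(** From [x], the recursion can be unfolded [r] times within [D]. *)
Fixpoint deep D r x : bool :=
  (x \in D) && (if r is r'.+1 then all (deep D r') (boundary x) else true).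

Let deep_mem D r x : deep D r x -> x \in D.
Proof. by case: r => [|r] /= /andP[]. Qed.

(** Each unfolding contracts by [p] for each of the at most [2 d] neighbours. A
    visible neighbour forces [x] to be empty in both windows, and there is
    nothing to unfold. *)
Let ratio1_dist D D' r x s : deep D r x -> deep D' r x -> sigma x = false ->
    vacant s sigma ->
  `|ratio D s [:: x] - ratio D' s [:: x]| <= (p * (2 * d)%:R) ^+ r.
Proof.
have q0 : 0 < 1 - p by rewrite subr_gt0 p1.
elim: r x s => [|r IH] x s /=.
  rewrite !andbT expr0 => xD xD' sx vac.
  have := ratio1_ge xD sx vac; have := ratio1_ge xD' sx vac.
  have := ratio_le1 D [:: x] vac; have := ratio_le1 D' [:: x] vac.
  by rewrite ler_norml; lra.
move=> /andP[xD /allP deepD] /andP[xD' /allP deepD'] sx vac.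
have [xs|xs] := boolP (x \in s).
  by rewrite !ratio1_mem// subrr normr0 exprn_ge0// mulr_ge0// ltW.
have [vacbd|/allPn[y ybd]] := boolP (vacant (boundary x) sigma); last first.
  rewrite negbK => sy; have yD := deep_mem (deepD y ybd).
  rewrite (ratio1_visible xD yD sx ybd sy vac).
  rewrite (ratio1_visible xD' (deep_mem (deepD' y ybd)) sx ybd sy vac).
  by rewrite subrr normr0 exprn_ge0// mulr_ge0// ltW.
have vacx : vacant (x :: s) sigma by rewrite /= sx.
rewrite !ratio1_rec// -[ratio D _ _]mul1r -[ratio D' _ _]mul1r.
apply: le_trans (ratio_recip_dist (e := (p * (2 * d)%:R) ^+ r) _ _ vacx _) _.
- move=> y ybd; split; [exact: deep_mem (deepD y ybd)|exact: deep_mem (deepD' y ybd)|].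
  exact/negbTE/(allP vacbd).
- move=> y t ybd vact; apply: IH => //; [exact: deepD|exact: deepD'|].
  exact/negbTE/(allP vacbd).
- by rewrite ler01 lexx.
rewrite exprS -mulrA ler_pM2l// -[leLHS]mulr_natl; apply: ler_wpM2r.
  by rewrite exprn_ge0// mulr_ge0// ltW.
by rewrite ler_nat size_boundary.
Qed.

(** The influence of the window decays exponentially with its distance to
    [ys], at a rate that does not depend on [sigma]. *)
Lemma void_ratio_dist D D' r ys :
    all (deep D r) ys -> all (deep D' r) ys -> vacant ys sigma ->
  `|Q D ys / Q D [::] - Q D' ys / Q D' [::]| <= (p * (2 * d)%:R) ^+ r *+ size ys.
Proof.
have Qrev D0 : Q D0 ys / Q D0 [::] = ratio D0 [::] ys.
  by congr (_ / _); apply: eq_mem_void_prob => x; rewrite catrevE cats0 mem_rev.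
rewrite !Qrev; have : vacant [::] sigma by [].
move: [::] => s; elim: ys s {Qrev} => [|y ys IH] s vac.
  by rewrite !ratio_nil// subrr normr0.
move=> /= /andP[dy dys] /andP[dy' dys'] /andP[sy vacys].
have vacy : vacant (y :: s) sigma by rewrite /= sy.
rewrite (@ratio_cons D _ _ _ vacy) (@ratio_cons D' _ _ _ vacy) mulrS.
have := IH _ vacy dys dys' vacys; have := ratio1_dist dy dy' (negbTE sy) vac.
have := ratio_le1 D' [:: y] vac; have := ratio_ge0 D' s [:: y].
have := ratio_le1 D ys vacy; have := ratio_ge0 D (y :: s) ys.
move: (ratio D s [:: y]) (ratio D' s [:: y]) => a b.
move: (ratio D (y :: s) ys) (ratio D' (y :: s) ys) => c c'.
move=> c0 c1 b0 b1 ab cc.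
have -> : a * c - b * c' = (a - b) * c + b * (c - c') by ring.
apply: le_trans (ler_normD _ _) (lerD _ _); rewrite normrM.
  by rewrite [X in _ * X]ger0_norm//; apply: le_trans ab; rewrite ler_piMr.
by rewrite ger0_norm//; apply: le_trans cc; rewrite ler_piMl.
Qed.

Lemma void_ratio_ge D ys : {subset ys <= D} -> vacant ys sigma ->
  (1 - p) ^+ size ys <= Q D ys / Q D [::].
Proof.
have -> : Q D ys / Q D [::] = ratio D [::] ys.
  by congr (_ / _); apply: eq_mem_void_prob => x; rewrite catrevE cats0 mem_rev.
have : vacant [::] sigma by [].
have q0 : 0 < 1 - p by rewrite subr_gt0 p1.
move: [::] => s; elim: ys s => [|y ys IH] s vac; first by rewrite ratio_nil.
move=> ysD /= /andP[sy vacys]; have vacy : vacant (y :: s) sigma by rewrite /= sy.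
rewrite (@ratio_cons _ _ _ _ vacy) exprS; apply: ler_pM; rewrite ?exprn_ge0 ?(ltW q0)//.
  by apply: ratio1_ge => //; [apply: ysD; rewrite mem_head|exact/negbTE].
by apply: IH => // z zys; apply: ysD; rewrite inE zys orbT.
Qed.

End Contraction.

(** * Conditional probabilities of the visible configuration *)

(** The constant [k] cancels: it compares the weights of two windows, and is
    not controlled as the windows grow. *)
Lemma normalized_dist (R : realFieldType) (I : finType) (u u' : I -> R) (k e : R) :
    0 < k -> (forall i, 0 <= u i) -> (forall i, 0 <= u' i) ->
    0 < \sum_i u i -> 0 < \sum_i u' i ->
    (forall i, `|u i - k * u' i| <= e * (k * u' i)) ->
  forall i, `|u i / (\sum_j u j) - u' i / (\sum_j u' j)| <= e + e.
Proof.
move=> k0 u0 u'0; set U := \sum_i u i; set U' := \sum_i u' i => U0 U'0 close i.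
have kU'0 : 0 < k * U' by rewrite mulr_gt0.
have leU' : u' i <= U' by rewrite /U' (bigD1 i)//= lerDl sumr_ge0.
have leU : u i <= U by rewrite /U (bigD1 i)//= lerDl sumr_ge0.
have closeU : `|U - k * U'| <= e * (k * U').
  rewrite /U /U' mulr_sumr -sumrB mulr_sumr.
  by apply: le_trans (ler_norm_sum _ _ _) _; apply: ler_sum => j _; exact: close.
have e0 : 0 <= e by rewrite -(pmulr_lge0 _ kU'0); apply: le_trans closeU.
have -> : u i / U - u' i / U' =
    (u i - k * u' i) / (k * U') - u i / U * ((U - k * U') / (k * U')).
  by field; rewrite !gt_eqF.
apply: le_trans (ler_normB _ _) (lerD _ _).
  rewrite normrM normfV (gtr0_norm kU'0) ler_pdivrMr//.
  apply: le_trans (close i) _; rewrite ler_wpM2l// ler_wpM2l//; exact: ltW.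
rewrite normrM [X in X * _]ger0_norm; last by rewrite divr_ge0 ?(ltW U0).
rewrite -[leRHS]mul1r; apply: ler_pM; rewrite ?divr_ge0 ?(ltW U0)//.
  by rewrite ler_pdivrMr// mul1r.
by rewrite normrM normfV (gtr0_norm kU'0) ler_pdivrMr.
Qed.

Section VisibleConditional.
Context (R : realType) (d : nat) (p : R) (hd : (1 <= d)%N).
Context (hp0 : 0 < p) (hp : p < (2 * d)%:R^-1).
Context (mu : probability (config d) R) (hmu : bernoulli_product p mu).
Implicit Types (D L S : {fset site d}) (x y : site d) (s : seq (site d)).
Implicit Types (sigma tau v w : config d).

Let p1 : p < 1.
Proof.
apply: lt_le_trans hp _; rewrite invf_le1 ?ltr0n ?muln_gt0//.
by rewrite -[1]/(1%:R) ler_nat muln_gt0.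
Qed.

Let u D v := void_prob mu D v [::].

Let u_ge0 D v : 0 <= u D v. Proof. exact: void_prob_ge0. Qed.

Let u_gt0 D sigma : nonisolates sigma = sigma -> 0 < u D sigma.
Proof. by move=> fs; exact: (void_prob_gt0 hp0 p1 hmu). Qed.

Let weight L v := \prod_(x <- (L : seq _)) bernoulli_pmf p (v x).

Lemma prob_event_sites S f s v : local_on S f -> uniq s ->
    (forall x, x \in s -> x \notin S) ->
  prob_event mu (fun w => f w && all (fun x => w x == v x) s) =
  (\prod_(x <- s) bernoulli_pmf p (v x)) * prob_event mu f.
Proof.
move=> fS; elim: s => [_ _|x s IH /= /andP[xs us] sS].
  by rewrite big_nil mul1r; congr prob_event; apply/funext => w; rewrite andbT.
rewrite big_cons -mulrA -IH//; last by move=> y ys; apply: sS; rewrite inE ys orbT.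
have loc : local_on (S `|` [fset y in s])%fset
    (fun w => f w && all (fun y => w y == v y) s).
  apply: local_on_and fS _ => w w' ww'; apply: eq_in_all => y ys.
  by rewrite ww'// inE.
rewrite -(@prob_event_site _ _ _ _ hmu _ _ x (v x) loc).
  by congr prob_event; apply/funext => w; rewrite -andbA; congr andb; rewrite andbC.
by rewrite !inE negb_or xs andbT sS// mem_head.
Qed.

Let zeros L v : seq (site d) := [seq x <- nbhd L | ~~ v x].

Let vacant_zeros L v : vacant (zeros L v) v.
Proof. by apply/allP => x; rewrite mem_filter => /andP[]. Qed.

(** This event looks at no site of [L]: what is seen at a site depends on its
    neighbours only, and those of a site off [nbhd L] are off [L]. *)
Let exterior L D v w :=
  visible (D `\` nbhd L)%fset v w && all (fun x => w x == v x) (nbhd L `\` L)%fset.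

(** Seeing [sigma] while the field vanishes on the zeros of [sigma] in [nbhd L]
    means that the field itself equals [sigma] on [nbhd L]. Since [sigma] has no
    isolated site, the sites of [nbhd L] are then seen as in [sigma] as soon as
    the other sites of [D] are. *)
Let void_factor L D sigma : nonisolates sigma = sigma -> (nbhd (nbhd L) `<=` D)%fset ->
  void_prob mu D sigma (zeros L sigma) =
  weight L sigma * prob_event mu (exterior L D sigma).
Proof.
move=> fix_sigma /fsubsetP LD.
have LB : {subset L <= nbhd L} by apply/fsubsetP; exact: sub_nbhd.
have BD x : x \in nbhd L -> x \in D by move=> xL; apply/LD/nbhdP; left.
rewrite -(@prob_event_sites (nbhd (D `\` nbhd L) `|` (nbhd L `\` L))%fset); last 3 first.
- apply: local_on_and; first exact: local_on_visible.
  exact: local_on_agree.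
- exact: fset_uniq.
- move=> x xL; rewrite in_fsetU in_fsetD xL /= orbF; apply/nbhdP => -[].
    by rewrite in_fsetD LB.
  move=> [y]; rewrite in_fsetD => /andP[yL _] xy; move: yL; apply/negP/negPn.
  by apply: (boundary_nbhd xL); rewrite boundaryC.
congr prob_event; apply/funext => w; rewrite /exterior; apply/idP/idP.
  move=> /andP[/allP vis /allP vac].
  have wB x : x \in nbhd L -> w x = sigma x.
    move=> xB; case sx : (sigma x); last first.
      by apply/negbTE/vac; rewrite mem_filter sx xB.
    by apply: nonisolates_sub; rewrite (eqP (vis x (BD x xB))).
  apply/andP; split; last by apply/allP => x /LB/wB ->.
  apply/andP; split; first by apply/allP => x; rewrite in_fsetD => /andP[_ /vis].
  by apply/allP => x; rewrite in_fsetD => /andP[_ /wB ->].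
move=> /andP[/andP[/allP vis /allP ann] /allP wL].
have wB x : x \in nbhd L -> w x = sigma x.
  move=> xB; have [/wL/eqP//|xL] := boolP (x \in L).
  by apply/eqP/ann; rewrite in_fsetD xL.
apply/andP; split; last first.
  by apply/allP => x; rewrite mem_filter => /andP[sx xB]; rewrite wB.
apply/allP => x xD; have [xB|xB] := boolP (x \in nbhd L); last first.
  by apply: vis; rewrite in_fsetD xB.
case sx : (sigma x); last first.
  by apply/eqP/negbTE/negP => /nonisolates_sub; rewrite wB// sx.
apply/eqP; have : nonisolates sigma x by rewrite fix_sigma.
move=> /nonisolates_has[y ybd]; rewrite fix_sigma => sy.
apply: (@nonisolates_pair _ w x y) => //; first by rewrite wB.
have [yB|yB] := boolP (y \in nbhd L); first by rewrite wB.
apply: nonisolates_sub; rewrite (eqP (vis y _))// in_fsetD yB.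
by apply/LD/(boundary_nbhd xB).
Qed.

Let exterior_splice L D (eta : {ffun L -> bool}) v :
  exterior L D (splice eta v) = exterior L D v.
Proof.
have LB : {subset L <= nbhd L} by apply/fsubsetP; exact: sub_nbhd.
apply/funext => w; congr andb; apply: eq_in_all => x; rewrite in_fsetD => /andP[xL _].
  by rewrite splice_out//; apply: contra xL => /LB.
by rewrite splice_out.
Qed.

(** An isolated site of the spliced configuration lies near [L], so that a
    large window sees it. *)
Let u_not_fixed L D (eta : {ffun L -> bool}) sigma :
    nonisolates sigma = sigma -> (nbhd (nbhd L) `<=` D)%fset ->
    nonisolates (splice eta sigma) <> splice eta sigma ->
  u D (splice eta sigma) = 0.
Proof.
move=> fix_sigma /fsubsetP LD not_fixed.
set tau := splice eta sigma in not_fixed *.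
have [x tx nx] : exists2 x, tau x & ~~ nonisolates tau x.
  apply: contra_notP not_fixed => no; apply/funext => x.
  apply/idP/idP => [/nonisolates_sub//|tx]; apply/negPn/negP => nx.
  by apply: no; exists x.
have xB : x \in nbhd L.
  apply/negPn/negP => xB; move/negP: nx; apply.
  have xL : x \notin L by apply: contra xB => /(fsubsetP (sub_nbhd L)).
  rewrite (@nonisolates_local _ tau sigma x).
  - by rewrite fix_sigma -(splice_out eta sigma xL).
  - exact: splice_out.
  move=> y yx; apply: splice_out; apply: contra xB => yL.
  by apply: (boundary_nbhd yL); rewrite boundaryC.
rewrite /u /void_prob /prob_event (_ : [set w | _] = set0) ?measure0//.
apply/seteqP; split => w //=; rewrite andbT => /allP vis.
have xD : x \in D by apply/LD/nbhdP; left.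
have : nonisolates w x by rewrite (eqP (vis x xD)).
move=> /nonisolates_has[y yx ny]; move/negP: nx; apply.
apply: (nonisolates_pair tx _ yx); rewrite -(eqP (vis y _))//.
exact/LD/(boundary_nbhd xB).
Qed.

Let deep_window r s : exists S, forall D, (S `<=` D)%fset -> all (deep D r) s.
Proof.
elim: r s => [|r IH] s.
  exists [fset x in s]%fset => D /fsubsetP sD; apply/allP => x xs /=.
  by rewrite andbT; apply: sD; rewrite inE.
have [S SD] := IH (flatten [seq (boundary x : seq _) | x <- s]).
exists (S `|` [fset x in s])%fset => D.
rewrite fsubUset => /andP[/SD /allP deepD /fsubsetP sD].
apply/allP => x xs /=; rewrite sD ?inE//=; apply/allP => y yx; apply: deepD.
by apply/flattenP; exists (boundary x : seq _) => //; exact: map_f.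
Qed.

Let void_ratio L D v := void_prob mu D v (zeros L v) / u D v.

(** The error is relative, which the lower bound [(1 - p) ^ N] on the void
    probability allows, and uniform in [tau]. *)
Let void_ratio_close L e : 0 < e -> exists S, forall D D',
  (S `<=` D)%fset -> (S `<=` D')%fset -> forall tau, nonisolates tau = tau ->
  `|void_ratio L D tau - void_ratio L D' tau| <= e * void_ratio L D tau.
Proof.
move=> e0; have q0 : 0 < 1 - p by rewrite subr_gt0.
pose N := size (nbhd L); pose rho : R := p * (2 * d)%:R.
have d0 : 0 < (2 * d)%:R :> R by rewrite ltr0n muln_gt0.
have rho0 : 0 <= rho by rewrite mulr_ge0// ltW.
have rho1 : rho < 1 by rewrite /rho -ltr_pdivlMr// mul1r.
have bound0 : 0 < e * (1 - p) ^+ N / N.+1%:R by rewrite divr_gt0 ?mulr_gt0 ?exprn_gt0.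
have [r rho_r] : exists r, rho ^+ r <= e * (1 - p) ^+ N / N.+1%:R.
  have /cvgrPdist_le/(_ _ bound0)[r _ /(_ r (leqnn r))] : rho ^+ r @[r --> \oo] --> 0.
    by apply: cvg_expr; rewrite ger0_norm.
  by rewrite /= sub0r normrN ger0_norm ?exprn_ge0//; exists r.
have [S SD] := deep_window r (nbhd L).
exists S => D D' /SD deepD /SD deepD' tau fix_tau.
have sub_all D0 : all (deep D0 r) (nbhd L) -> all (deep D0 r) (zeros L tau).
  by move=> /allP a; apply/allP => x; rewrite mem_filter => /andP[_ /a].
have sizeN : (size (zeros L tau) <= N)%N by rewrite size_filter count_size.
apply: le_trans (void_ratio_dist hd hp0 hp hmu fix_tau (sub_all _ deepD)
  (sub_all _ deepD') (vacant_zeros L tau)) _.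
apply: le_trans (_ : e * (1 - p) ^+ N <= _); last first.
  rewrite ler_pM2l//; apply: le_trans (_ : (1 - p) ^+ size (zeros L tau) <= _).
    by rewrite ler_wiXn2l// ?(ltW q0)// lerBlDr lerDl ltW.
  apply: (void_ratio_ge hd hp0 hp hmu fix_tau) => //.
  by move=> x /(allP (sub_all _ deepD)); case: (r) => [|r'] /= /andP[].
rewrite -mulr_natl; apply: le_trans (_ : N.+1%:R * (e * (1 - p) ^+ N / N.+1%:R) <= _).
  apply: ler_pM; rewrite ?exprn_ge0// ler_nat; exact: leqW.
by rewrite mulrC mulfVK// pnatr_eq0.
Qed.

Let total L D v := \sum_(eta : {ffun L -> bool}) u D (splice eta v).

Let cond L D v := u D v / total L D v.

Let total_gt0 L D sigma : nonisolates sigma = sigma -> 0 < total L D sigma.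
Proof.
move=> fs; rewrite /total (bigD1 (restr L sigma))//= splice_restr// ltr_wpDr ?u_gt0//.
by apply: sumr_ge0.
Qed.

Let cond_close L e : 0 < e -> exists S, forall D D',
  (S `<=` D)%fset -> (S `<=` D')%fset ->
  forall sigma (eta : {ffun L -> bool}), nonisolates sigma = sigma ->
  `|cond L D (splice eta sigma) - cond L D' (splice eta sigma)| <= e.
Proof.
move=> e0; have [S SD] := void_ratio_close L (divr_gt0 e0 (ltr0n R 2)).
exists (S `|` nbhd (nbhd L))%fset => D D'.
rewrite !fsubUset => /andP[sD LD] /andP[sD' LD'] sigma eta fix_sigma.
rewrite /cond /total !splice_sum [leRHS]splitr.
pose C D0 := prob_event mu (exterior L D0 sigma).
have void_gt0 D0 tau : nonisolates tau = tau -> 0 < void_prob mu D0 tau (zeros L tau).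
  by move=> ft; apply: (void_prob_gt0 hp0 p1 hmu) => //; exact: vacant_zeros.
have factor D0 tau : (nbhd (nbhd L) `<=` D0)%fset -> nonisolates tau = tau ->
    exterior L D0 tau = exterior L D0 sigma ->
    u D0 tau = weight L tau * C D0 / void_ratio L D0 tau.
  move=> LD0 ft ext; rewrite /C -ext -void_factor// /void_ratio invf_div mulrCA.
  rewrite divff ?mulr1//.
  by rewrite gt_eqF// void_gt0.
have C_gt0 D0 : (nbhd (nbhd L) `<=` D0)%fset -> 0 < C D0.
  move=> LD0; rewrite lt_neqAle prob_event_ge0 andbT eq_sym; apply/eqP => C0.
  by have := void_gt0 D0 sigma fix_sigma; rewrite void_factor// -/(C D0) C0 mulr0 ltxx.
apply: (@normalized_dist _ _ (fun zeta => u D (splice zeta sigma))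
  (fun zeta => u D' (splice zeta sigma)) (C D / C D')) => //.
- by rewrite divr_gt0// C_gt0.
- exact: total_gt0.
- exact: total_gt0.
move=> zeta; set tau := splice zeta sigma.
have [ft|nft] := pselect (nonisolates tau = tau); last first.
  by rewrite !(u_not_fixed fix_sigma _ nft)// !mulr0 subrr normr0.
have ext D0 : exterior L D0 tau = exterior L D0 sigma by exact: exterior_splice.
have h0 D0 : 0 < void_ratio L D0 tau by rewrite divr_gt0 ?void_gt0 ?u_gt0.
have close := SD D D' sD sD' tau ft.
have C0 := C_gt0 D' LD'; have CD0 := C_gt0 D LD.
have w0 : 0 <= weight L tau.
  by apply: prodr_ge0 => x _; rewrite /bernoulli_pmf; case: ifP; rewrite ?subr_ge0 ltW.
rewrite (factor D)// (factor D')//.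
move: (h0 D) (h0 D') close => hD hD'.
move: (void_ratio L D tau) (void_ratio L D' tau) hD hD' => h h' hh hh' close.
move: (weight L tau) (C D) (C D') w0 CD0 C0 => W c c' W0 c0 c'0.
have -> : W * c / h - c / c' * (W * c' / h') = W * c / (h * h') * (h' - h).
  by field; rewrite !gt_eqF.
have -> : e / 2 * (c / c' * (W * c' / h')) = W * c / (h * h') * (e / 2 * h).
  by field; rewrite !gt_eqF.
have k0 : 0 <= W * c / (h * h') by rewrite divr_ge0 ?mulr_ge0// ltW.
by rewrite normrM ger0_norm// ler_wpM2l// distrC.
Qed.


Let window n : {fset site d} := [fset x in pmap choice.unpickle (iota 0 n)]%fset.

Let window_sup S : \forall n \near \oo, (S `<=` window n)%fset.
Proof.
exists (\max_(x <- S) (choice.pickle x).+1) => // n /= Sn; apply/fsubsetP => x xS.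
rewrite !inE mem_pmap; apply/mapP.
exists (choice.pickle x); last exact/esym/choice.pickleK.
rewrite mem_iota /= add0n; apply: leq_trans Sn.
exact: (@leq_bigmax_seq _ _ xpredT (fun x => (choice.pickle x).+1)).
Qed.

Let density L v : R := limn (fun n => cond L (window n) v).

Let cond_ge0 L D v : 0 <= cond L D v.
Proof. by rewrite divr_ge0// sumr_ge0. Qed.

Let cvg_density L (eta : {ffun L -> bool}) sigma : nonisolates sigma = sigma ->
  cond L (window n) (splice eta sigma) @[n --> \oo] --> density L (splice eta sigma).
Proof.
move=> fs; apply/cauchy_cvgP/cauchy_exP => e /= e0.
have e2 : 0 < e / 2 :> R by rewrite divr_gt0.
have [S SD] := cond_close L e2.
exists (cond L S (splice eta sigma)); near=> n => /=.
rewrite /ball /=; apply: le_lt_trans (SD _ _ _ _ _ _ fs) _ => //.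
- by near: n; exact: window_sup.
- by rewrite ltr_pdivrMr// ltr_pMr// ltr1n.
Unshelve. all: by end_near. Qed.

Let density_close L e : 0 < e -> exists S, forall D, (S `<=` D)%fset ->
  forall sigma (eta : {ffun L -> bool}), nonisolates sigma = sigma ->
  `|density L (splice eta sigma) - cond L D (splice eta sigma)| <= e.
Proof.
move=> e0; have [S SD] := cond_close L e0; exists S => D sD sigma eta fs.
apply/ler_addgt0Pr => e' e'0.
have /cvgrPdist_le/(_ _ e'0) := @cvg_density L eta sigma fs.
move=> /(filterI (window_sup S))/filter_ex[n [/= Sn close]].
apply: le_trans (ler_distD (cond L (window n) (splice eta sigma)) _ _) _.
by rewrite addrC lerD// SD.
Qed.

Lemma visible_densities :
  conditional_densities (distribution mu (@nonisolates' d)) density.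
Proof.
have uE D v := distribution_visible mu D v.
have cvgG L (eta : {ffun L -> bool}) (w : config' d) :=
  @cvg_density L eta (val w) (nonisolates_val w).
split.
- move=> L eta w; apply: (limr_ge (cvgP _ (cvgG L eta w))).
  by apply: nearW => n; exact: cond_ge0.
- move=> L eta w not_fixed; apply: (cvg_unique _ (cvgG L eta w)) => //.
  apply: cvg_near_cst; near=> n; rewrite /cond u_not_fixed ?mul0r ?nonisolates_val//.
  by near: n; exact: window_sup.
- move=> L w.
  have sumG : \sum_(eta : {ffun L -> bool}) cond L (window n) (splice eta (val w))
      @[n --> \oo] --> \sum_(eta : {ffun L -> bool}) density L (splice eta (val w)).
    by apply: cvg_big => [|eta _]; [exact: add_continuous|exact: cvgG].
  apply: (cvg_unique _ sumG) => //; apply: cvg_near_cst; apply: nearW => n.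
  rewrite /cond /total; under eq_bigr do rewrite splice_sum.
  by rewrite -mulr_suml mulfV// gt_eqF// total_gt0// nonisolates_val.
- move=> L D LD w; have fw := nonisolates_val w.
  have cvg_w K : cond K (window n) (val w) @[n --> \oo] --> density K (val w).
    by have := cvgG K (restr K (val w)) w; rewrite splice_restr.
  apply: (cvg_unique _ (cvg_w D)) => //.
  have sumG : \sum_(eta : {ffun L -> bool}) cond D (window n) (splice eta (val w))
      @[n --> \oo] --> \sum_(eta : {ffun L -> bool}) density D (splice eta (val w)).
    apply: cvg_big => [|eta _]; first exact: add_continuous.
    by rewrite -(splice_widen eta (val w) LD); exact: cvgG.
  apply: cvg_trans (cvgM (cvg_w L) sumG); apply: near_eq_cvg; apply: nearW => n.
  have totalD (eta : {ffun L -> bool}) :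
      total D (window n) (splice eta (val w)) = total D (window n) (val w).
    by rewrite -(splice_widen eta (val w) LD) /total splice_sum.
  rewrite /= /GRing.mul_fun /= /cond; under eq_bigr do rewrite totalD.
  rewrite -mulr_suml -/(total L (window n) (val w)) mulrA mulfVK//.
  by rewrite gt_eqF// total_gt0.
- move=> L e e0; have [S SD] := density_close L e0; exists S => D sD.
  exists (cond L D); split; first last.
  + move=> v; rewrite uE; under eq_bigr do rewrite uE.
    rewrite -/(total L D v) /cond.
    have [t0|t0] := eqVneq (total L D v) 0; last by rewrite mulfVK.
    rewrite t0 mulr0; apply/eqP; rewrite eq_le u_ge0 andbT -t0 /total.
    by rewrite (bigD1 (restr L v))//= splice_restr// lerDl sumr_ge0.
  + by move=> eta w; apply: SD => //; exact: nonisolates_val.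
  + have uD : local_on D (u D).
      move=> v v' vv'; congr prob_event; apply/funext => w; congr andb.
      by apply: eq_in_all => x xD; rewrite vv'.
    move=> v v' vv'; rewrite /cond (uD _ _ vv'); congr (_ / _).
    by apply: eq_bigr => eta _; apply: uD; exact: splice_agree.
Unshelve. all: by end_near. Qed.

End VisibleConditional.

(** * The empty field *)

Section Ground.
Context (d : nat).
Implicit Types (D L S : {fset site d}) (x y : site d) (v w : config d).

Let occ L v : nat := \sum_(x <- (L : seq _)) v x.

(** Changing a configuration without isolated sites on [L] can isolate sites of
    [nbhd L] only, so that inspecting these decides whether the result is
    admissible. *)
Let valid L v := all (fun x => v x ==> has v (boundary x)) (nbhd L).

Let ground L v := valid L v &&
  [forall eta : {ffun L -> bool},
    valid L (splice eta v) ==> (occ L v <= occ L (splice eta v))%N].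

Let grounds L v := #|[set eta : {ffun L -> bool} | ground L (splice eta v)]%SET|.

(** The limit of the conditional probabilities as the density vanishes: only
    the patterns with the fewest occupied sites survive, with equal weights. *)
Definition ground_density (R : realType) L v : R := (ground L v)%:R / (grounds L v)%:R.

Let fixed w := nonisolates w = w.

Let validP L (eta : {ffun L -> bool}) w : fixed w ->
  reflect (fixed (splice eta w)) (valid L (splice eta w)).
Proof.
move=> fw; apply: (iffP idP) => [/allP vv|fv]; last first.
  apply/allP => x _; apply/implyP => vx.
  by move: vx; rewrite -[X in X x]fv nonisolatesE => /andP[].
apply/funext => x; apply/idP/idP => [/nonisolates_sub//|vx].
have [xL|xL] := boolP (x \in nbhd L).
  by rewrite nonisolatesE vx; have /implyP := vv x xL; apply.
rewrite (@nonisolates_local _ _ w); first last.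
- move=> y yx; apply: splice_out; apply: contra xL => yL.
  by apply: (boundary_nbhd yL); rewrite boundaryC.
- by apply: splice_out; apply: contra xL; apply/fsubsetP/sub_nbhd.
rewrite fw; move: vx; rewrite splice_out//.
by apply: contra xL; apply/fsubsetP/sub_nbhd.
Qed.

Let groundP L (eta : {ffun L -> bool}) w : fixed w ->
  reflect (fixed (splice eta w) /\ forall zeta : {ffun L -> bool},
             fixed (splice zeta w) -> (occ L (splice eta w) <= occ L (splice zeta w))%N)
          (ground L (splice eta w)).
Proof.
move=> fw; apply: (iffP andP) => -[v mv]; split; try exact/(validP _ fw).
  move=> zeta fz; have /forallP/(_ zeta) := mv.
  by rewrite splice_splice => /implyP; apply; apply/(validP _ fw).
by apply/forallP => zeta; rewrite splice_splice; apply/implyP => /(validP _ fw)/mv.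
Qed.

Let grounds_splice L (eta : {ffun L -> bool}) w : grounds L (splice eta w) = grounds L w.
Proof. by apply: eq_card => zeta; rewrite !inE splice_splice. Qed.

Let grounds_gt0 L w : fixed w -> (0 < grounds L w)%N.
Proof.
move=> fw; apply/card_gt0P.
have v0 : valid L (splice (restr L w) w) by apply/(validP _ fw); rewrite splice_restr.
case: (@arg_minnP _ (restr L w) (fun eta => valid L (splice eta w))
  (fun eta => occ L (splice eta w)) v0) => eta ve me.
exists eta; rewrite inE; apply/(groundP _ fw); split; first exact/(validP _ fw).
by move=> zeta /(validP _ fw)/me.
Qed.

Let local_on_ground L : local_on (nbhd (nbhd L)) (ground L).
Proof.
have local_valid : local_on (nbhd (nbhd L)) (valid L).
  move=> v w vw; apply: eq_in_all => x xL; congr (_ ==> _).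
    by apply: vw; apply/nbhdP; left.
  by apply: eq_in_has => y yx; apply: vw; exact: (boundary_nbhd xL).
have local_occ : local_on (nbhd (nbhd L)) (occ L).
  move=> v w vw; apply: eq_big_seq => x xL; rewrite vw//.
  by do 2 (apply/nbhdP; left).
move=> v w vw; rewrite /ground (local_valid v w vw) (local_occ v w vw); congr andb.
apply: eq_forallb => eta; have vw' := splice_agree eta vw.
by rewrite (local_valid _ _ vw') (local_occ _ _ vw').
Qed.

Let local_on_ground_density (R : realType) L :
  local_on (nbhd (nbhd L)) (@ground_density R L).
Proof.
move=> v w vw; rewrite /ground_density (local_on_ground vw); congr (_ / _%:R).
by apply: eq_card => eta; rewrite !inE; apply: local_on_ground; exact: splice_agree.
Qed.

(** A minimiser in [D] also minimises in [L], and by exchange every minimiser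
    in [L] with the same pattern off [L] is then one in [D]. *)
Let ground_sub L D w (eta0 : {ffun L -> bool}) : (L `<=` D)%fset -> fixed w ->
    ground D (splice eta0 w) ->
  forall eta : {ffun L -> bool}, ground D (splice eta w) = ground L (splice eta w).
Proof.
move=> LD fw g0 eta; have /fsubsetP LDs := LD.
have lift (e : {ffun L -> bool}) := esym (splice_widen e w LD).
have occD v : (forall x, x \notin L -> v x = w x) ->
    occ D v = (occ L v + \sum_(x <- (D `\` L)%fset) w x)%N.
  move=> vw; rewrite /occ (big_fsetID _ (fun x => x \in L)) /=; congr addn.
    apply: congr_big => //; congr enum_fset; apply/fsetP => x; rewrite !inE /=.
    by apply/andP/idP => [[]//|xL]; rewrite xL LDs.
  rewrite (_ : [fset x | x in D & x \notin L]%fset = (D `\` L)%fset); last first.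
    by apply/fsetP => x; rewrite !inE andbC.
  by apply: eq_big_seq => x; rewrite inE => /andP[xL _]; rewrite vw.
have occDe (e : {ffun L -> bool}) := occD (splice e w) (fun x => @splice_out _ _ e w x).
have gP (e : {ffun L -> bool}) :
    reflect (fixed (splice e w) /\ forall zeta : {ffun D -> bool},
               fixed (splice zeta w) -> (occ D (splice e w) <= occ D (splice zeta w))%N)
            (ground D (splice e w)).
  by rewrite (lift e); exact: groundP.
have [f0 m0] := gP _ g0.
apply/gP/groundP => // -[fe me]; split=> // zeta.
  by rewrite {1}lift => /me; rewrite -lift !occDe leq_add2r.
by move=> /m0; apply: leq_trans; rewrite !occDe leq_add2r me.
Qed.

Let empty : config d := fun=> false.

Let fixed_empty : fixed empty.
Proof. by apply/funext => x; rewrite nonisolatesE. Qed.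

Let ground_empty L (eta : {ffun L -> bool}) :
  ground L (splice eta empty) = (eta == [ffun=> false]).
Proof.
have splice0 : splice ([ffun=> false] : {ffun L -> bool}) empty = empty.
  by apply/funext => x; rewrite /splice; case: insubP => // y; rewrite ffunE.
have occ0 : occ L empty = 0%N by rewrite /occ big1.
apply/(groundP _ fixed_empty)/eqP => [[_ /(_ [ffun=> false])]|->].
  rewrite splice0 occ0 leqn0 => /(_ fixed_empty) /eqP occ_eta.
  apply/ffunP => x; rewrite ffunE -(splice_val eta empty).
  move: occ_eta; rewrite /occ (big_fsetD1 (val x)) ?valP//=.
  by move=> /eqP; rewrite addn_eq0 => /andP[]; case: splice.
by rewrite splice0; split=> [|zeta _]; rewrite ?occ0.
Qed.

Section EmptyField.
Context (R : realType) (mu : probability (config d) R).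
Context (hmu : bernoulli_product 0 mu).

Let visible_prob D v : void_prob mu D v [::] = (vacant D v)%:R.
Proof.
have [vac|/allPn[x xD]] := boolP (vacant D v); last first.
  rewrite negbK => vx; apply/eqP; rewrite eq_le prob_event_ge0 andbT.
  have p0 : prob_event mu (fun w => all (fun y => w y == true) [fset x]%fset) = 0.
    by rewrite (prob_event_agree hmu _ (fun=> true)) big_seq_fset1.
  rewrite -[leRHS]p0.
  apply: prob_event_mono; [exact: local_on_void|exact: local_on_agree|].
  move=> w /andP[/allP vis _]; apply/allP => y; rewrite inE => /eqP ->.
  by rewrite eqb_id; apply: nonisolates_sub; rewrite (eqP (vis x xD)).
have := prob_event_agree hmu (nbhd D) empty.
rewrite (eq_big_seq (fun=> 1)); last by move=> x _; rewrite /bernoulli_pmf subr0.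
rewrite big1// => one; apply/eqP; rewrite eq_le; apply/andP; split.
  rewrite -lee_fin (EFin_prob_event mu (@local_on_void _ D v [::])).
  exact: (probability_le1 mu (measurable_local_event (@local_on_void _ D v [::]))).
rewrite -one; apply: prob_event_mono; [exact: local_on_agree|exact: local_on_void|].
move=> w /allP wD; rewrite andbT; apply/allP => x xD.
rewrite (negbTE (allP vac x xD)) eqbF_neg; apply/negP => /nonisolates_sub.
by rewrite (eqP (wD x _))//; apply/nbhdP; left.
Qed.

Lemma ground_densities :
  conditional_densities (distribution mu (@nonisolates' d)) (@ground_density R).
Proof.
have sum_ground L w :
    \sum_(eta : {ffun L -> bool}) (ground L (splice eta w))%:R = (grounds L w)%:R :> R.
  rewrite -natr_sum; congr _%:R; rewrite /grounds -sum1_card [RHS]big_mkcond /=.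
  by apply: eq_bigr => eta _; rewrite inE; case: ground.
split.
- by move=> L eta w; rewrite divr_ge0.
- move=> L eta w not_fixed; rewrite /ground_density.
  rewrite (_ : ground _ _ = false) ?mul0r//; apply/negP.
  by move=> /(groundP _ (nonisolates_val w))[].
- move=> L w; rewrite /ground_density; under eq_bigr do rewrite grounds_splice.
  rewrite -mulr_suml sum_ground mulfV// pnatr_eq0 -lt0n.
  exact/grounds_gt0/nonisolates_val.
- move=> L D LD w; rewrite /ground_density; have fw := nonisolates_val w.
  have groundsD (eta : {ffun L -> bool}) :
      grounds D (splice eta (val w)) = grounds D (val w).
    by rewrite -(splice_widen eta (val w) LD); exact: grounds_splice.
  under eq_bigr do rewrite groundsD.
  rewrite -mulr_suml mulrA; congr (_ / _).
  have [/existsP[eta0 g0]|no] :=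
      boolP [exists eta : {ffun L -> bool}, ground D (splice eta (val w))].
    have eqg := ground_sub LD fw g0.
    under eq_bigr do rewrite eqg.
    rewrite sum_ground mulfVK ?pnatr_eq0 -?lt0n ?grounds_gt0//.
    by have := eqg (restr L (val w)); rewrite splice_restr// => ->.
  have g0 (eta : {ffun L -> bool}) : ground D (splice eta (val w)) = false.
    by apply: contraNF no => g; apply/existsP; exists eta.
  have := g0 (restr L (val w)); rewrite splice_restr// => ->.
  by rewrite big1 ?mulr0// => eta _; rewrite g0.
move=> L e e0; exists (nbhd (nbhd L)) => D LD; exists (@ground_density R L); split.
- exact: local_on_sub LD (@local_on_ground_density R L).
- by move=> eta w; rewrite subrr normr0 ltW.
move=> v; under eq_bigr do rewrite distribution_visible visible_prob.
rewrite distribution_visible visible_prob.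
have LDs : {subset L <= D}.
  by move=> x xL; apply/(fsubsetP LD)/nbhdP; left; apply/nbhdP; left.
pose zero : {ffun L -> bool} := [ffun=> false].
have vacE (eta : {ffun L -> bool}) : vacant D (splice eta v) =
    (eta == zero) && all (fun x => (x \in L) || ~~ v x) D.
  apply/allP/andP => [vac|[/eqP -> /allP vac] x xD].
    split; last first.
      apply/allP => x xD; have [//|xL] := boolP (x \in L).
      by have := vac x xD; rewrite splice_out.
    by apply/eqP/ffunP => x; rewrite ffunE -(splice_val eta v); apply/negbTE/vac/LDs/valP.
  have [xL|xL] := boolP (x \in L); last first.
    by rewrite splice_out//; have := vac x xD; rewrite (negbTE xL).
  by rewrite -[x]/(val [` xL]%fset) splice_val ffunE.
have vac_v := vacE (restr L v); rewrite splice_restr// in vac_v.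
rewrite vac_v; under eq_bigr do rewrite vacE.
case vac : (all _ D); last first.
  by rewrite andbF big1 ?mulr0// => eta _; rewrite andbF.
rewrite andbT (bigD1 zero)//= eqxx big1 ?addr0 ?mulr1; last first.
  by move=> eta /negbTE ->.
have -> : ground_density R L v = ground_density R L (splice (restr L v) empty).
  apply: local_on_ground_density => x xN; have [xL|xL] := boolP (x \in L).
    by rewrite splice_restr_in.
  rewrite splice_out//; apply/negbTE.
  by have := allP vac x (fsubsetP LD x xN); rewrite (negbTE xL).
rewrite /ground_density grounds_splice ground_empty -/zero.
rewrite (_ : grounds L empty = 1%N) ?divr1//.
rewrite /grounds -(card1 zero); apply: eq_card => eta.
by rewrite !inE ground_empty.
Qed.

End EmptyField.

End Ground.

Theorem theorem2p2 (R : realType) (d : nat) (hd : (1 <= d)%N) (p : R)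
    (hp01 : 0 <= p <= 1) (hp : p < (2 * d)%:R^-1)
    (mu : probability (config d) R) (hmu : bernoulli_product p mu) :
  exists gamma : specification R d,
    quasilocal gamma /\ specification_for gamma (distribution mu (@nonisolates' d)).
Proof.
have [p0|p_neq0] := eqVneq p 0.
  by subst p; exact: specification_of_densities (ground_densities hmu).
have p_gt0 : 0 < p by rewrite lt_neqAle eq_sym p_neq0; case/andP: hp01.
exact: specification_of_densities (visible_densities hd p_gt0 hp hmu).
Qed.
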